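(* Let $\Pi$ be a (finite, nonempty) set of patterns, the longest of which has length $k$. The values $|S_1(\Pi)|,\dots,|S_n(\Pi)|$ can be computed in time $O(|S_{\le n-1}(\Pi)|\cdot k)$ and space $O(n^k)$.
   Context: A permutation in $S_m$ is a word containing each of $1,\dots,m$ exactly once; $S_{\le n}=S_1\cup\dots\cup S_n$. For $\pi\in S_m$ and $\tau\in S_n$, a $\pi$-hit in $\tau$ is an $m$-letter subsequence of $\tau$ order-isomorphic to $\pi$; $\tau$ avoids $\Pi$ if it has no $\pi$-hit for any $\pi\in\Pi$; $S_m(\Pi)$ (resp. $S_{\le n}(\Pi)$) is the set of permutations in $S_m$ (resp. $S_{\le n}$) avoiding $\Pi$. Model of computation: a word RAM with words of $\Theta(n)$ bits (enough that a permutation of length at most $n$ with letters in fixed-width bit blocks, and an $(n+1)$-bit map, fit in a constant number of words), in which standard integer operations, bitwise operations, shifts, popcount (number of 1-bits) and ctz (number of trailing zero bits) take constant time, and hash tables keyed by such words support insertion, deletion and lookup in constant time; space is measured in machine words.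
   Formalization: Time is O(max(1, |S_{≤n-1}(Π)|·k)), since the product is 0 when n = 1 or 1 ∈ Π; the patterns of length at most n are given in a hash table, so reading Π costs no time; words have at least A·n·b bits, where b-bit blocks hold the letters; output cells start at zero. *)

(* Defs.v *)
From Stdlib Require Import PeanoNat.
From HB Require Import structures.
From mathcomp Require Import all_boot finmap.
Set Implicit Arguments. Unset Strict Implicit. Unset Printing Implicit Defensive.

(** * Permutations as words, pattern hits, avoidance *)

Definition is_perm (m : nat) (s : seq nat) : bool := perm_eq s (iota 1 m).

Definition order_iso (u v : seq nat) : bool :=
  (size u == size v) &&
  [forall i : 'I_(size u), forall j : 'I_(size u),
     (nth 0 u i < nth 0 u j) == (nth 0 v i < nth 0 v j)].

(* A subsequence of tau is selected by a mask with one bit per letter of tau. *)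
Definition has_hit (pi tau : seq nat) : bool :=
  [exists msk : (size tau).-tuple bool, order_iso (mask msk tau) pi].

Definition avoids (Pi : seq (seq nat)) (tau : seq nat) : bool :=
  all (fun pi => ~~ has_hit pi tau) Pi.

(* [permutations s] is duplicate-free, so sizes of these lists are
   cardinalities. *)
Definition avoiders (Pi : seq (seq nat)) (m : nat) : seq (seq nat) :=
  [seq tau <- permutations (iota 1 m) | avoids Pi tau].

(* |S_1(Pi)| + ... + |S_n(Pi)|; the empty word is not counted. *)
Definition num_avoiders_le (Pi : seq (seq nat)) (n : nat) : nat :=
  \sum_(1 <= m < n.+1) size (avoiders Pi m).

(* Finite sets of patterns are given by lists; only membership matters. *)
Definition pattern_set (Pi : seq (seq nat)) : bool :=
  (Pi != [::]) && all (fun pi => (0 < size pi) && is_perm (size pi) pi) Pi.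

Definition max_length (Pi : seq (seq nat)) : nat := \max_(pi <- Pi) size pi.

(** * Word RAM with w-bit words and hash tables *)

Inductive unop := OpNot | OpPopcount | OpCtz.

Inductive binop :=
  | OpAdd | OpSub | OpMul | OpDiv | OpMod
  | OpAnd | OpOr | OpXor | OpShl | OpShr | OpEq | OpLt.

(* Words are the naturals below 2 ^ w.  Arithmetic is modulo 2 ^ w;
   x / 0 = 0, x mod 0 = x, and ctz 0 = w. *)
Definition eval_unop (w : nat) (o : unop) (x : nat) : nat :=
  match o with
  | OpNot => 2 ^ w - 1 - x
  | OpPopcount => \sum_(i < w) Nat.testbit x i
  | OpCtz => find (Nat.testbit x) (iota 0 w)
  end.

Definition eval_binop (w : nat) (o : binop) (x y : nat) : nat :=
  match o with
  | OpAdd => (x + y) %% 2 ^ w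
  | OpSub => (x + 2 ^ w - y) %% 2 ^ w
  | OpMul => (x * y) %% 2 ^ w
  | OpDiv => x %/ y
  | OpMod => x %% y
  | OpAnd => Nat.land x y
  | OpOr  => Nat.lor x y
  | OpXor => Nat.lxor x y
  | OpShl => (x * 2 ^ y) %% 2 ^ w
  | OpShr => x %/ 2 ^ y
  | OpEq  => x == y
  | OpLt  => x < y
  end.

(* r, x, y, a, key are register numbers (r the destination, a the one holding a
   memory address), c is a literal and h names a hash table. *)
Inductive instr :=
  | Const (r c : nat)
  | Un (o : unop) (r x : nat)
  | Bin (o : binop) (r x y : nat)
  | Read (r a : nat)
  | Write (a x : nat)
  | HMem (h r key : nat)
  | HGet (h r key : nat)
  | HInsert (h key x : nat)
  | HDelete (h key : nat).

Inductive prog :=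
  | Do (i : instr)
  | Seq (p q : prog)
  | If (r : nat) (p q : prog)
  | While (r : nat) (p : prog).

(* [table] holds all hash tables at once, keyed by (table name, key).
   [top] is a bound on the memory addresses reserved or accessed so far. *)
Record state := State {
  regs : nat -> nat;
  memory : nat -> nat;
  table : {fmap nat * nat -> nat};
  top : nat }.

Definition set_reg (s : state) (r v : nat) : state :=
  State [eta regs s with r |-> v] (memory s) (table s) (top s).

Definition touch (s : state) (a : nat) : state :=
  State (regs s) (memory s) (table s) (maxn (top s) a.+1).

Definition set_mem (s : state) (a v : nat) : state :=
  State (regs s) [eta memory s with a |-> v] (table s) (top s).

Definition set_table (s : state) (T : {fmap nat * nat -> nat}) : state :=
  State (regs s) (memory s) T (top s).

Definition exec_instr (w : nat) (i : instr) (s : state) : state :=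
  match i with
  | Const r c => set_reg s r (c %% 2 ^ w)
  | Un o r x => set_reg s r (eval_unop w o (regs s x))
  | Bin o r x y => set_reg s r (eval_binop w o (regs s x) (regs s y))
  | Read r a => set_reg (touch s (regs s a)) r (memory s (regs s a))
  | Write a x => set_mem (touch s (regs s a)) (regs s a) (regs s x)
  | HMem h r key => set_reg s r ((h, regs s key) \in domf (table s))
  | HGet h r key => set_reg s r (odflt 0 (table s).[? (h, regs s key)]%fmap)
  | HInsert h key x =>
      set_table s (table s).[(h, regs s key) <- regs s x]%fmap
  | HDelete h key => set_table s (table s).[~ (h, regs s key)]%fmap
  end.

(* Words in use: memory up to the highest address ever accessed, and two words
   (key and value) per hash-table entry.  Registers are not counted: a program
   uses a fixed number of them. *)
Definition space (s : state) : nat := top s + 2 * #|` domf (table s)|%fset.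

(* [exec w p s t q s']: on w-bit words, p started in s halts in s' after t unit
   time steps (instructions and tests), with peak space q. *)
Inductive exec (w : nat) : prog -> state -> nat -> nat -> state -> Prop :=
  | ExecDo i s :
      exec w (Do i) s 1 (maxn (space s) (space (exec_instr w i s)))
           (exec_instr w i s)
  | ExecSeq p1 p2 s1 s2 s3 t1 t2 q1 q2 :
      exec w p1 s1 t1 q1 s2 -> exec w p2 s2 t2 q2 s3 ->
      exec w (Seq p1 p2) s1 (t1 + t2) (maxn q1 q2) s3
  | ExecIfT r p1 p2 s s' t q :
      regs s r != 0 -> exec w p1 s t q s' -> exec w (If r p1 p2) s t.+1 q s'
  | ExecIfF r p1 p2 s s' t q :
      regs s r = 0 -> exec w p2 s t q s' -> exec w (If r p1 p2) s t.+1 q s'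
  | ExecWhileF r p s :
      regs s r = 0 -> exec w (While r p) s 1 (space s) s
  | ExecWhileT r p s1 s2 s3 t1 t2 q1 q2 :
      regs s1 r != 0 -> exec w p s1 t1 q1 s2 ->
      exec w (While r p) s2 t2 q2 s3 ->
      exec w (While r p) s1 (t1 + t2).+1 (maxn q1 q2) s3.

(** * Input *)

(* The letter in position i occupies bits b * i, ..., b * i + b - 1. *)
Definition encode (b : nat) (tau : seq nat) : nat :=
  \sum_(i < size tau) nth 0 tau i * 2 ^ (b * i).

(* Only patterns of length at most n are loaded: longer ones need not fit in a
   word and do not affect |S_1(Pi)|, ..., |S_n(Pi)|. *)
Definition pattern_table (b n : nat) (Pi : seq (seq nat)) :
    {fmap nat * nat -> nat} :=
  foldr (fun pi T => T.[(0, encode b pi) <- 0])%fmap [fmap]%fmap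
        [seq pi <- Pi | size pi <= n].

(* Registers 0, 1, 2 hold n, min(k, n) and the block width b, where k is the
   length of the longest pattern; hash table 0 holds the patterns.  All other
   registers and the memory are zero.  Cells 0, ..., n are reserved from the
   start, cells 1, ..., n being the output. *)
Definition init_state (b n : nat) (Pi : seq (seq nat)) : state :=
  State (fun r => nth 0 [:: n; minn (max_length Pi) n; b] r) (fun=> 0)
        (pattern_table b n Pi) n.+1.

(* Main.v *)
Require Import Defs.
From Stdlib Require Import PeanoNat.
From HB Require Import structures.
From mathcomp Require Import all_boot finmap zify.
Set Implicit Arguments. Unset Strict Implicit. Unset Printing Implicit Defensive.

(** Grow permutations by inserting a new maximum, and attach to an avoider of
    length l the bitmap of the l + 1 positions where the next maximum may be
    inserted without creating a hit.  A hit of a pattern of length at most k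
    misses one of the k + 1 largest letters, so an insertion into tau is legal
    iff the result is not itself a pattern and the corresponding insertion is
    legal in each permutation obtained from tau by deleting one of its
    K = min(k, n) largest letters.  The bitmap of tau is thus the conjunction
    of K known bitmaps, each with one bit duplicated at the deleted position,
    and a new avoider costs O(k) steps.  Avoiders of length n are only counted,
    as the 1-bits in the bitmaps of the avoiders of length n - 1.

    For the space bound, the avoiders of length d are handled in levels, each
    consisting of those that extend one fixed avoider of length d - (K - 1);
    all the deletions needed for a level lie in the preceding one.  The tree of
    levels is searched depth first and a level is erased once its sublevels
    are done, so there is at most one level of each length at a time, with at
    most n ^ (K - 1) members. *)

(** * Words of fixed-width blocks *)

Lemma encode_nil b : encode b [::] = 0.
Proof. by rewrite /encode big_ord0. Qed.

Lemma encode_cons b x s : encode b (x :: s) = x + 2 ^ b * encode b s.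
Proof.
rewrite /encode big_ord_recl /= muln0 expn0 muln1 big_distrr /=; congr (_ + _).
by apply: eq_bigr => i _; rewrite mulnS expnD mulnCA.
Qed.

Lemma encode_cat b s1 s2 :
  encode b (s1 ++ s2) = encode b s1 + 2 ^ (b * size s1) * encode b s2.
Proof.
elim: s1 => [|x s1 IH]; first by rewrite encode_nil muln0 mul1n.
by rewrite cat_cons !encode_cons IH /= mulnDr addnA mulnS expnD mulnA.
Qed.

Definition small b := all (fun x => x < 2 ^ b).

Lemma encode_lt b s : small b s -> encode b s < 2 ^ (b * size s).
Proof.
elim: s => [|x s IH] /=; first by rewrite encode_nil muln0.
case/andP=> hx /IH hs; rewrite encode_cons mulnS expnD.
apply: (@leq_trans (2 ^ b * (encode b s).+1)); last by rewrite leq_mul2l hs orbT.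
by rewrite mulnS ltn_add2r.
Qed.

Lemma small_take b p s : small b s -> small b (take p s).
Proof. by rewrite /small -{1}(cat_take_drop p s) all_cat => /andP[]. Qed.

Lemma small_drop b p s : small b s -> small b (drop p s).
Proof. by rewrite /small -{1}(cat_take_drop p s) all_cat => /andP[]. Qed.

Lemma small_map (T : Type) b (f : T -> nat) s :
  (forall x, f x < 2 ^ b) -> small b [seq f x | x <- s].
Proof. by move=> h; elim: s => //= x s ->; rewrite h. Qed.

Lemma encode_divmod b p s : small b s ->
  encode b s %% 2 ^ (b * p) = encode b (take p s) /\
  encode b s %/ 2 ^ (b * p) = encode b (drop p s).
Proof.
move=> hs; have [hp|hp] := leqP p (size s); last first.
  have hlt : encode b s < 2 ^ (b * p).
    by apply: leq_trans (encode_lt hs) _; rewrite leq_exp2l // leq_mul2l ltnW ?orbT.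
  by rewrite modn_small // divn_small // take_oversize ?drop_oversize ?encode_nil // ltnW.
have hlt := encode_lt (small_take p hs); rewrite size_takel // in hlt.
rewrite -[in encode b s](cat_take_drop p s) encode_cat size_takel // mulnC.
rewrite addnC.
by rewrite modnMDl modn_small // divnMDl ?expn_gt0 // divn_small // addn0.
Qed.

Lemma encode_take b p s : small b s ->
  encode b (take p s) = encode b s %% 2 ^ (b * p).
Proof. by case/(encode_divmod p). Qed.

Lemma encode_drop b p s : small b s ->
  encode b (drop p s) = encode b s %/ 2 ^ (b * p).
Proof. by case/(encode_divmod p). Qed.

Lemma encode_head b s : small b s -> encode b s %% 2 ^ b = nth 0 s 0.
Proof.
case: s => [|x s] /=; first by rewrite encode_nil mod0n.
by case/andP=> hx _; rewrite encode_cons mulnC addnC modnMDl modn_small.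
Qed.

Lemma encode_inj b s t : small b s -> small b t -> 0 \notin s -> 0 \notin t ->
  encode b s = encode b t -> s = t.
Proof.
elim: s t => [|x s IH] [|y t] //=.
- by move=> _ /andP[_ _] _; rewrite inE encode_nil encode_cons; case: y.
- by move=> /andP[_ _] _; rewrite inE encode_nil encode_cons; case: x.
move=> /andP[hx hs] /andP[hy ht]; rewrite !inE !negb_or => /andP[_ h0s] /andP[_ h0t] E.
have Exy : x = y.
  have := @encode_head b (x :: s); have := @encode_head b (y :: t).
  by rewrite -E /= hx hy => /(_ ht) -> /(_ hs).
subst y; congr (_ :: _); apply: IH => //; move/eqP: E.
by rewrite !encode_cons eqn_add2l eqn_pmul2l ?expn_gt0 // => /eqP.
Qed.

(** * Permutations as insertion sequences *)

Definition ins (s : seq nat) p v := take p s ++ v :: drop p s.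
Definition del (s : seq nat) p := take p s ++ drop p.+1 s.

Lemma size_ins s p v : size (ins s p v) = (size s).+1.
Proof. by rewrite /ins size_cat /= addnS -size_cat cat_take_drop. Qed.

Lemma encode_ins b s p v : small b s -> p <= size s ->
  encode b (ins s p v) = encode b s %% 2 ^ (b * p) + v * 2 ^ (b * p)
    + encode b s %/ 2 ^ (b * p) * 2 ^ (b * p + b).
Proof.
move=> hs hp; rewrite /ins encode_cat encode_cons size_takel //.
by rewrite encode_take // encode_drop // expnD; nia.
Qed.

Lemma encode_del b s p : small b s -> p < size s ->
  encode b (del s p) = encode b s %% 2 ^ (b * p)
    + encode b s %/ 2 ^ (b * p + b) * 2 ^ (b * p).
Proof.
move=> hs hp; rewrite /del encode_cat size_takel 1?ltnW //.
by rewrite encode_take // encode_drop // mulnS [b + _]addnC [2 ^ _ * _]mulnC.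
Qed.

(* [ps] lists the positions at which the letters were inserted as new maxima,
   the most recent insertion first. *)
Fixpoint perm_of (ps : seq nat) : seq nat :=
  if ps is p :: ps' then ins (perm_of ps') p (size ps) else [::].

Fixpoint valid (ps : seq nat) : bool :=
  if ps is p :: ps' then (p <= size ps') && valid ps' else true.

Lemma size_perm_of ps : size (perm_of ps) = size ps.
Proof. by elim: ps => //= p ps IH; rewrite size_ins IH. Qed.

Lemma perm_ins s p v : perm_eq (ins s p v) (v :: s).
Proof. by rewrite /ins perm_catC /= perm_cons perm_catC cat_take_drop. Qed.

Lemma perm_iotaS m : perm_eq (iota 1 m.+1) (m.+1 :: iota 1 m).
Proof. by rewrite -[X in iota _ X]addn1 iotaD perm_catC add1n. Qed.

Lemma perm_of_perm ps : is_perm (size ps) (perm_of ps).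
Proof.
rewrite /is_perm; elim: ps => //= p ps IH.
apply: (perm_trans (perm_ins _ _ _)); rewrite -[1 :: _]/(iota 1 (size ps).+1).
by rewrite perm_sym (perm_trans (perm_iotaS _)) // perm_cons perm_sym.
Qed.

Lemma mem_perm_of ps v : (v \in perm_of ps) = (0 < v <= size ps).
Proof. by rewrite (perm_mem (perm_of_perm ps)) mem_iota add1n ltnS. Qed.

Lemma perm_of_uniq ps : uniq (perm_of ps).
Proof. by rewrite (perm_uniq (perm_of_perm ps)) iota_uniq. Qed.

Lemma index_ins s p v : v \notin s -> p <= size s -> index v (ins s p v) = p.
Proof.
move=> hv hp; rewrite /ins index_cat ifN ?(contra (@mem_take _ _ _ _)) //=.
by rewrite eqxx addn0 size_takel.
Qed.

Lemma filter_ins s p v : v \notin s -> [seq x <- ins s p v | x != v] = s.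
Proof.
move=> hv; rewrite /ins filter_cat /= eqxx /= -filter_cat cat_take_drop.
by apply/all_filterP/allP => x hx; apply: contraNneq hv => <-.
Qed.

Lemma perm_of_inj ps qs : valid ps -> valid qs ->
  perm_of ps = perm_of qs -> ps = qs.
Proof.
elim: ps qs => [|p ps IH] [|q qs] //=.
- by move=> _ _ /(congr1 size); rewrite size_ins.
- by move=> _ _ /(congr1 size); rewrite size_ins.
move=> /andP[hp vps] /andP[hq vqs] E.
have Esz : size ps = size qs.
  by have := congr1 size E; rewrite !size_ins !size_perm_of; case.
have hn t : size t = size ps -> (size ps).+1 \notin perm_of t.
  by move=> Et; rewrite mem_perm_of Et ltnn andbF.
have hnq := hn qs (esym Esz); rewrite -Esz in E hq; congr (_ :: _).
  have := congr1 (index (size ps).+1) E.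
  by rewrite !index_ins ?size_perm_of ?hn // -Esz.
apply: IH => //; have := congr1 (filter (fun x => x != (size ps).+1)) E.
by rewrite !filter_ins ?hn.
Qed.

Lemma perm_of_surj m s : is_perm m s ->
  exists2 ps, valid ps && (size ps == m) & perm_of ps = s.
Proof.
rewrite /is_perm; elim: m s => [|m IH] s hs.
  by exists [::] => //; apply/esym/perm_nilP; rewrite perm_sym in hs *.
have hm : m.+1 \in s by rewrite (perm_mem hs) mem_iota add1n ltnS leqnn.
pose p := index m.+1 s; pose t := del s p.
have Es : s = ins t p m.+1.
  have hp : p < size s by rewrite index_mem.
  have hpt : size (take p s) = p by rewrite size_takel // ltnW.
  rewrite /ins /t /del take_cat hpt ltnn subnn take0 cats0.
  rewrite drop_cat hpt ltnn subnn drop0 -[X in X :: _](nth_index 0 hm).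
  by rewrite -drop_nth // cat_take_drop.
have ht : perm_eq t (iota 1 m).
  rewrite -(perm_cons m.+1); apply: perm_trans (_ : perm_eq _ (ins t p m.+1)) _.
    by rewrite perm_sym perm_ins.
  by rewrite -Es (perm_trans hs) // perm_iotaS.
case: (IH t ht) => ps /andP[vps /eqP Em] Et; exists (p :: ps); last first.
  by rewrite /= Et Em -Es.
rewrite /= vps Em eqxx !andbT.
have : p < size s by rewrite index_mem.
by rewrite (perm_size hs) size_iota.
Qed.

(** * Hits and deletion of a letter *)

Lemma order_isoP u v : reflect
  (size u = size v /\ forall i j, i < size u -> j < size u ->
     (nth 0 u i < nth 0 u j) = (nth 0 v i < nth 0 v j))
  (order_iso u v).
Proof.
apply: (iffP andP) => [[/eqP E /forallP h]|[E h]]; split => //.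
- move=> i j hi hj; have /forallP := h (Ordinal hi).
  by move/(_ (Ordinal hj))/eqP.
- exact/eqP.
by apply/forallP => i; apply/forallP => j; apply/eqP/h.
Qed.

Lemma order_iso_map (f : nat -> nat) u v :
  {in u &, {mono f : x y / x < y}} -> order_iso (map f u) v = order_iso u v.
Proof.
move=> fm; apply/order_isoP/order_isoP; rewrite size_map => -[E h]; split=> // i j hi hj.
  by rewrite -h // !(nth_map 0) // fm ?mem_nth.
by rewrite !(nth_map 0) // fm ?mem_nth // h.
Qed.

Lemma is_perm_rank m s i : is_perm m s -> i < size s ->
  nth 0 s i = (count (fun j => nth 0 s j < nth 0 s i) (iota 0 (size s))).+1.
Proof.
move=> hs hi; have : nth 0 s i \in iota 1 m by rewrite -(perm_mem hs) mem_nth.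
rewrite mem_iota add1n ltnS => /andP[h0 hm]; set v := nth 0 s i in h0 hm *.
have -> : count (fun j => nth 0 s j < v) (iota 0 (size s)) = count (fun x => x < v) s.
  by rewrite -[in RHS](mkseq_nth 0 s) count_map.
have /permP -> := hs; have -> : m = v.-1 + (m - v.-1) by lia.
rewrite iotaD count_cat.
have /eqP -> : count (fun x => x < v) (iota 1 v.-1) == v.-1.
  by rewrite -{2}(size_iota 1 v.-1) -all_count; apply/allP => x; rewrite mem_iota; lia.
have /eqP -> : count (fun x => x < v) (iota (1 + v.-1) (m - v.-1)) == 0.
  by rewrite -leqn0 leqNgt -has_count; apply/hasPn => x; rewrite mem_iota; lia.
by lia.
Qed.

Lemma order_iso_perm m s t : is_perm m s -> is_perm m t ->
  order_iso s t -> s = t.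
Proof.
move=> hs ht /order_isoP[E h]; apply: (@eq_from_nth _ 0) => // i hi.
rewrite (is_perm_rank hs) // (is_perm_rank ht) -?E //; congr _.+1.
by apply: eq_in_count => j; rewrite mem_iota add0n => /andP[_ hj]; rewrite h.
Qed.

Lemma has_hitP pi tau :
  reflect (exists2 u, subseq u tau & order_iso u pi) (has_hit pi tau).
Proof.
apply: (iffP existsP) => [[msk h]|[u /subseqP[m hm ->] h]].
  by exists (mask msk tau) => //; exact: mask_subseq.
by exists (Tuple (introT eqP hm)).
Qed.

Definition delval v s := [seq unbump v x | x <- s & x != v].

Lemma unbump_mono v : {in predC1 v &, {mono unbump v : x y / x < y}}.
Proof. by move=> x y; rewrite !inE /unbump; lia. Qed.

Lemma filter_mono v u :
  {in [seq x <- u | x != v] &, {mono unbump v : x y / x < y}}.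
Proof. by move=> x y; rewrite !mem_filter => /andP[hx _] /andP[hy _]; exact: unbump_mono. Qed.

Lemma subseq_map_inv (T1 T2 : eqType) (f : T1 -> T2) (s : seq T1) (u : seq T2) :
  subseq u (map f s) -> exists2 t, subseq t s & u = map f t.
Proof.
case/subseqP=> m; rewrite size_map => hm ->.
by exists (mask m s); [exact: mask_subseq | rewrite map_mask].
Qed.

Lemma has_hit_delval v pi s : has_hit pi (delval v s) -> has_hit pi s.
Proof.
case/has_hitP => u /subseq_map_inv[t ht ->] hu; apply/has_hitP; exists t.
  exact: subseq_trans ht (filter_subseq _ _).
by rewrite order_iso_map in hu => // x y hx hy; apply: filter_mono; apply: (mem_subseq ht).
Qed.

Lemma avoids_delval Pi v s : avoids Pi s -> avoids Pi (delval v s).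
Proof. by move/allP=> h; apply/allP => pi /h; apply: contra; exact: has_hit_delval. Qed.

Lemma has_hit_omit v u pi s : subseq u s -> v \notin u -> order_iso u pi ->
  has_hit pi (delval v s).
Proof.
move=> hu hv ho; have fu : [seq x <- u | x != v] = u.
  by apply/all_filterP/allP => x hx; apply: contraNneq hv => <-.
have hu' : subseq u [seq x <- s | x != v].
  by rewrite subseq_filter hu andbT -[u in all _ u]fu filter_all.
apply/has_hitP; exists (map (unbump v) u); first exact: map_subseq.
by rewrite order_iso_map // -[u]fu; exact: filter_mono.
Qed.

Lemma avoids_by_deletion Pi k n K m s :
  (forall pi, pi \in Pi -> is_perm (size pi) pi /\ size pi <= k) ->
  K = minn k n -> is_perm m.+1 s -> m < n ->
  avoids Pi s = (s \notin Pi) &&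
    all (fun i => avoids Pi (delval (m.+1 - i) s)) (iota 0 (minn K m).+1).
Proof.
move=> hPi EK hs hm; apply/idP/idP => [h|].
  apply/andP; split; last by apply/allP => i _; exact: avoids_delval.
  apply/negP => hin; move/allP/(_ s hin)/negP: h; apply; apply/has_hitP.
  by exists s => //; apply/order_isoP.
case/andP=> hsPi /allP hdel; apply/allP => pi hpi; apply/negP => /has_hitP[u hus hu].
have [ppi kpi] := hPi pi hpi; have /order_isoP[Esz _] := hu.
have Es : size s = m.+1 by rewrite (perm_size hs) size_iota.
have us := size_subseq hus; rewrite Es in us.
have [E|ne] := eqVneq (size u) m.+1.
  have Eu : u = s by apply/eqP; rewrite -(size_subseq_leqif hus) E Es.
  subst u; move/negP: hsPi; apply; rewrite (order_iso_perm hs _ hu) //.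
  by rewrite -E Esz.
have hum : size u <= m by lia.
have [v hv hvu] : exists2 v, v \in [seq m.+1 - i | i <- iota 0 (minn K m).+1] & v \notin u.
  apply/hasP; rewrite has_predC; apply/negP => /allP hall.
  have un : uniq [seq m.+1 - i | i <- iota 0 (minn K m).+1].
    rewrite map_inj_in_uniq ?iota_uniq // => i j; rewrite !mem_iota; lia.
  have := uniq_leq_size un hall; rewrite size_map size_iota leqNgt => /negP; apply.
  by rewrite ltnS leq_min hum andbT EK leq_min Esz kpi -Esz (leq_trans hum) // ltnW.
case/mapP: hv hvu => i hi -> hvu; move/allP/(_ pi hpi)/negP: (hdel i hi); apply.
exact: has_hit_omit hus hvu hu.
Qed.

(* Positions of the letters in decreasing order of the letters. *)
Fixpoint tops (ps : seq nat) : seq nat :=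
  if ps is p :: ps' then p :: [seq bump p q | q <- tops ps'] else [::].

Fixpoint del_top i (ps : seq nat) : seq nat :=
  if ps is p :: ps' then
    if i is i'.+1 then unbump (nth 0 (tops ps') i') p :: del_top i' ps' else ps'
  else [::].

Lemma size_tops ps : size (tops ps) = size ps.
Proof. by elim: ps => //= p ps IH; rewrite size_map IH. Qed.

Lemma index_ins_neq v x s p : v != x -> v \in s ->
  index v (ins s p x) = bump p (index v s).
Proof.
move=> vx vs; rewrite /ins index_cat /= [x == v]eq_sym (negPf vx) in_take // /bump.
have Ei : index v s = if index v s < p then index v (take p s)
                      else size (take p s) + index v (drop p s).
  by rewrite -[in LHS](cat_take_drop p s) index_cat in_take.
move: Ei; have [hi|hi] := ltnP (index v s) p => Ei; first by rewrite -Ei.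
by rewrite addnS -Ei.
Qed.

Lemma nth_tops ps i : valid ps -> i < size ps ->
  nth 0 (tops ps) i = index (size ps - i) (perm_of ps).
Proof.
elim: ps i => //= p ps IH [|i] /andP[hp hv] hi.
  by rewrite subn0 index_ins ?size_perm_of // mem_perm_of ltnn andbF.
rewrite [LHS]/= (nth_map 0) ?size_tops // IH // subSS index_ins_neq //; first by lia.
by rewrite mem_perm_of; lia.
Qed.

Lemma nth_tops_lt ps i : valid ps -> i < size ps -> nth 0 (tops ps) i < size ps.
Proof.
by move=> hv hi; rewrite nth_tops // -[X in _ < X]size_perm_of index_mem mem_perm_of; lia.
Qed.

Lemma size_del_top i ps : i < size ps -> size (del_top i ps) = (size ps).-1.
Proof.
by elim: ps i => //= p ps IH [|i] //= hi; rewrite IH // prednK //; case: ps hi {IH}.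
Qed.

Lemma drop_del_top i j ps : i <= j -> drop j (del_top i ps) = drop j.+1 ps.
Proof.
elim: ps i j => [|p ps IH] [|i] [|j] //=; rewrite ltnS => /IH ->.
by case: ps {IH}.
Qed.

Lemma delval_cat v s t : delval v (s ++ t) = delval v s ++ delval v t.
Proof. by rewrite /delval filter_cat map_cat. Qed.

Lemma size_delval_take v s p : uniq s -> v \in s -> p <= size s ->
  size (delval v (take p s)) = unbump (index v s) p.
Proof.
move=> us vs hp; rewrite /delval size_map size_filter /unbump -in_take //.
have := count_predC (pred1 v) (take p s); rewrite size_takel //.
by rewrite count_uniq_mem ?take_uniq // => E; rewrite -[p in p - _]E addKn.
Qed.

Lemma delval_max v s : {in s, forall x, x < v} -> delval v s = s.
Proof.
move=> h; rewrite /delval (_ : filter _ s = s); last first.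
  by apply/all_filterP/allP => x /h; lia.
by rewrite -[RHS]map_id; apply/eq_in_map => x /h; rewrite /unbump; lia.
Qed.

Lemma del_top_spec i ps : valid ps -> i < size ps ->
  valid (del_top i ps) /\ perm_of (del_top i ps) = delval (size ps - i) (perm_of ps).
Proof.
elim: ps i => //= p ps IH [|i] /andP[hp hv] hi.
  split=> //; rewrite subn0 /ins delval_cat /delval /= eqxx /= -/(delval _ _) -/(delval _ _).
  rewrite -delval_cat cat_take_drop delval_max // => x; rewrite mem_perm_of; lia.
have [vd Ed] := IH i hv hi; set v := size ps - i.
have vin : v \in perm_of ps by rewrite mem_perm_of /v; lia.
have hp' : unbump (nth 0 (tops ps) i) p <= (size ps).-1.
  by rewrite /unbump; have := nth_tops_lt hv hi; lia.
rewrite /= vd size_del_top // hp'; split=> //; rewrite Ed prednK; last by lia.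
rewrite nth_tops // -/v subSS -/v.
have hsz := size_delval_take (perm_of_uniq ps) vin.
have {}hsz : size (delval v (take p (perm_of ps))) = unbump (index v (perm_of ps)) p.
  by rewrite hsz // size_perm_of.
rewrite /ins delval_cat -[in delval v (perm_of ps)](cat_take_drop p (perm_of ps)) delval_cat.
rewrite take_cat hsz ltnn subnn take0 cats0 drop_cat hsz ltnn subnn drop0.
congr (_ ++ _); rewrite /delval /= ifT; last by rewrite /v; lia.
by congr (_ :: _); rewrite /unbump /v; lia.
Qed.

Lemma encode_decr b s t p : size s = size t -> p < size t ->
  nth 0 s p = (nth 0 t p).+1 -> (forall j, j != p -> nth 0 s j = nth 0 t j) ->
  encode b s = encode b t + 2 ^ (b * p).
Proof.
move=> E hp Ep Ej; rewrite /encode E (bigD1 (Ordinal hp)) //= Ep mulSn.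
rewrite [X in _ = X + _](bigD1 (Ordinal hp)) //= -addnA addnC; congr (_ + _).
congr (_ + _); apply: eq_bigr => i; rewrite -val_eqE /= => hi; by rewrite Ej.
Qed.

(* Decrementing the largest letters one at a time reduces the deletion of the
   (i+1)-st largest letter to the removal of a single block. *)
Definition lowered i ps := [seq v - (size ps - i < v) | v <- perm_of ps].

Lemma lowered0 ps : lowered 0 ps = perm_of ps.
Proof.
rewrite /lowered -[RHS]map_id; apply/eq_in_map => v; rewrite mem_perm_of; lia.
Qed.

Lemma size_lowered i ps : size (lowered i ps) = size ps.
Proof. by rewrite size_map size_perm_of. Qed.

Lemma small_perm_of b ps : size ps < 2 ^ b -> small b (perm_of ps).
Proof. by move=> h; apply/allP => v; rewrite mem_perm_of; lia. Qed.

Lemma small_lowered b i ps : size ps < 2 ^ b -> small b (lowered i ps).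
Proof. by move=> h; apply/allP => v /mapP[x]; rewrite mem_perm_of; lia. Qed.

Lemma nth_lowered i ps j : nth 0 (lowered i ps) j =
  nth 0 (perm_of ps) j - (size ps - i < nth 0 (perm_of ps) j).
Proof.
have [hj|hj] := ltnP j (size ps).
  by rewrite (nth_map 0) ?size_perm_of.
by rewrite !nth_default ?size_map ?size_perm_of.
Qed.

Lemma encode_lowered b i ps : valid ps -> i < size ps ->
  encode b (lowered i ps) =
    encode b (lowered i.+1 ps) + 2 ^ (b * nth 0 (tops ps) i).
Proof.
move=> hv hi; have hp := nth_tops_lt hv hi.
have vin : size ps - i \in perm_of ps by rewrite mem_perm_of; lia.
apply: encode_decr; rewrite ?size_lowered //; last move=> j.
  by rewrite !nth_lowered nth_tops // nth_index //; lia.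
rewrite !nth_lowered nth_tops // => hj.
suff : nth 0 (perm_of ps) j != size ps - i by lia.
have [hjs|hjs] := ltnP j (size ps); last first.
  by rewrite nth_default ?size_perm_of //; lia.
apply: contraNneq hj => <-; rewrite index_uniq ?size_perm_of //.
exact: perm_of_uniq.
Qed.

Lemma del_lowered i ps : valid ps -> i < size ps ->
  del (lowered i.+1 ps) (nth 0 (tops ps) i) = perm_of (del_top i ps).
Proof.
move=> hv hi; have [_ ->] := del_top_spec hv hi.
rewrite nth_tops // /del /lowered -map_take -map_drop -map_cat -remE.
rewrite (rem_filter _ (perm_of_uniq _)) /delval.
apply/eq_in_map => x; rewrite mem_filter /= /unbump; lia.
Qed.

(** * Bitmaps *)

Lemma testbit_encode l i :
  Nat.testbit (encode 1 (map nat_of_bool l)) i = nth false l i.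
Proof.
elim: l i => [|x l IH] i; first by rewrite encode_nil nth_nil Nat.bits_0.
rewrite map_cons encode_cons expn1 addnC; case: x => /=.
  case: i => [|i]; first exact: Nat.testbit_odd_0.
  by rewrite (Nat.testbit_odd_succ _ i (Nat.le_0_l _)) IH.
rewrite addn0; case: i => [|i]; first exact: Nat.testbit_even_0.
by rewrite (Nat.testbit_even_succ _ i (Nat.le_0_l _)) IH.
Qed.

Definition bits m (f : pred nat) := encode 1 [seq nat_of_bool (f q) | q <- iota 0 m].

Lemma bitsE m f : bits m f = encode 1 (map nat_of_bool [seq f q | q <- iota 0 m]).
Proof. by rewrite /bits -map_comp. Qed.

Lemma testbit_bits m f i : Nat.testbit (bits m f) i = (i < m) && f i.
Proof.
rewrite bitsE testbit_encode; have [hi|hi] := ltnP i m.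
  by rewrite (nth_map 0) ?size_iota // nth_iota.
by rewrite nth_default // size_map size_iota.
Qed.

Lemma small_bits m f : small 1 [seq nat_of_bool (f q) | q <- iota 0 m].
Proof. by apply: small_map => x; case: (f x). Qed.

Lemma bits_lt m f : bits m f < 2 ^ m.
Proof. by have := encode_lt (small_bits m f); rewrite size_map size_iota mul1n. Qed.

Lemma eq_bits m f g : (forall q, q < m -> f q = g q) -> bits m f = bits m g.
Proof.
by move=> h; congr (encode 1 _); apply/eq_in_map => q; rewrite mem_iota => /h ->.
Qed.

Lemma land_bits m f g :
  Nat.land (bits m f) (bits m g) = bits m (fun q => f q && g q).
Proof.
apply: Nat.bits_inj => i; rewrite Nat.land_spec !testbit_bits.
by case: (i < m).
Qed.

Lemma popcount_bits w m f : m <= w ->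
  eval_unop w OpPopcount (bits m f) = count f (iota 0 m).
Proof.
move=> hm /=; rewrite -sum1_count -(big_mkord xpredT (fun i => Nat.testbit (bits m f) i : nat)).
rewrite (big_cat_nat (leq0n m) hm) //= addnC big_nat_cond big1 => [|i]; last first.
  by rewrite testbit_bits; case: ltnP => // h; rewrite andbT => /andP[]; lia.
rewrite add0n [RHS]big_mkcond /= -[in RHS](subn0 m) -/(index_iota 0 m).
rewrite big_nat_cond [RHS]big_nat_cond; apply: eq_bigr => i /andP[/andP[_ hi] _].
by rewrite testbit_bits hi; case: (f i).
Qed.

Lemma ctz_bits w m p l : p < m -> m <= w -> all (ltn p) l ->
  eval_unop w OpCtz (bits m [in p :: l]) = p.
Proof.
move=> hp hm /allP hl /=; have -> : w = p + (w - p.+1).+1 by lia.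
rewrite iotaD find_cat size_iota /= testbit_bits add0n hp inE eqxx /= addn0.
rewrite ifN //; apply/hasPn => q; rewrite mem_iota add0n testbit_bits => /andP[_ hq].
rewrite !inE; apply/negP => /andP[_ /orP[/eqP|/hl /=]]; lia.
Qed.

Lemma bits_pop m p l : p < m -> p \notin l ->
  bits m [in p :: l] = bits m [in l] + 2 ^ p.
Proof.
move=> hp hl; rewrite -[p in 2 ^ p]mul1n; apply: encode_decr.
- by rewrite !size_map.
- by rewrite size_map size_iota.
- by rewrite !(nth_map 0) ?size_iota // nth_iota // inE eqxx (negPf hl).
move=> j hj; have [hjm|hjm] := ltnP j m; last by rewrite !nth_default ?size_map ?size_iota.
by rewrite !(nth_map 0) ?size_iota // nth_iota // inE (negPf hj).
Qed.

Lemma bits_nil m : bits m [in [::]] = 0.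
Proof.
rewrite /bits; elim: (iota 0 m) => [|x s IH]; first by rewrite encode_nil.
by rewrite /= encode_cons IH muln0.
Qed.

Lemma bits_filter m f : bits m f = bits m [in [seq q <- iota 0 m | f q]].
Proof. by apply: eq_bits => q hq; rewrite mem_filter mem_iota hq !andbT. Qed.

Lemma bits_expand m f p : p < m ->
  bits m f %% 2 ^ p.+1 + bits m f %/ 2 ^ p * 2 ^ p.+1
    = bits m.+1 (fun q => f (unbump p q)).
Proof.
move=> hp; have sb := small_bits m f.
have [E1 _] := encode_divmod p.+1 sb; have [_ E2] := encode_divmod p sb.
rewrite !mul1n in E1 E2; rewrite {1 2}/bits E1 E2 mulnC.
have -> : m.+1 = p.+1 + (m - p) by lia.
rewrite /bits iotaD map_cat encode_cat size_map size_iota mul1n -map_take -map_drop.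
rewrite add0n take_iota drop_iota add0n; have -> : minn p.+1 m = p.+1 by lia.
have E0 : iota p.+1 (m - p) = map succn (iota p (m - p)).
  by rewrite -[p.+1]add1n iotaDl; apply: eq_map => x; rewrite add1n.
rewrite E0 -map_comp; congr (encode 1 _ + _ * encode 1 _).
  by apply/eq_in_map => q; rewrite mem_iota /unbump => h; congr (nat_of_bool (f _)); lia.
by apply/eq_in_map => q; rewrite mem_iota /unbump /= => h; congr (nat_of_bool (f _)); lia.
Qed.

Lemma bits_ones m : bits m predT = 2 ^ m - 1.
Proof.
rewrite /bits; set a := (a in iota a _); elim: m a => [|m IH] a; first by rewrite encode_nil.
rewrite /= encode_cons IH expn1 expnS; have : 0 < 2 ^ m by rewrite expn_gt0.
by lia.
Qed.

Lemma bits_rcons m f : bits m.+1 f = bits m f + f m * 2 ^ m.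
Proof.
rewrite /bits -[X in iota 0 X]addn1 iotaD map_cat encode_cat /=.
rewrite encode_cons encode_nil size_map size_iota.
by rewrite mul1n muln0 addn0 mulnC.
Qed.

Lemma encode_inj_size b s t : small b s -> small b t -> size s = size t ->
  encode b s = encode b t -> s = t.
Proof.
elim: s t => [|x s IH] [|y t] //= /andP[hx hs] /andP[hy ht] [Es] E.
have Exy : x = y.
  have := @encode_head b (x :: s); have := @encode_head b (y :: t).
  by rewrite -E /= hx hy => /(_ ht) -> /(_ hs).
subst y; congr (_ :: _); apply: IH => //; move/eqP: E.
by rewrite !encode_cons eqn_add2l eqn_pmul2l ?expn_gt0 // => /eqP.
Qed.

(** * The tree of avoiders *)

Section Tree.
Variables (Pi : seq (seq nat)) (n : nat).

Definition avoiding ps := avoids Pi (perm_of ps).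
Definition ext ps := [seq q :: ps | q <- iota 0 (size ps).+1 & avoiding (q :: ps)].
(* Avoiders of length n - 1 are leaves: their extensions are counted, but not
   generated. *)
Definition children ps := if size ps < n.-1 then ext ps else [::].
Definition expand L := flatten [seq children ps | ps <- L].
Definition descend j ps := iter j expand [:: ps].
Definition good ps := [&& valid ps, avoiding ps & size ps < n].

Lemma expand_cat L1 L2 : expand (L1 ++ L2) = expand L1 ++ expand L2.
Proof. by rewrite /expand map_cat flatten_cat. Qed.

Lemma iter_expand_cat j L1 L2 :
  iter j expand (L1 ++ L2) = iter j expand L1 ++ iter j expand L2.
Proof. by elim: j => //= j ->; rewrite expand_cat. Qed.

Lemma iter_expand_nil j : iter j expand [::] = [::].
Proof. by elim: j => //= j ->. Qed.

Lemma avoiding_behead q ps : valid (q :: ps) -> avoiding (q :: ps) -> avoiding ps.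
Proof.
move=> hv h; have [] := @del_top_spec 0 (q :: ps) hv => //= _.
rewrite /avoiding => ->; exact: avoids_delval.
Qed.

Lemma avoiding_del_top i ps : valid ps -> i < size ps -> avoiding ps -> avoiding (del_top i ps).
Proof. by move=> hv hi h; have [_ E] := del_top_spec hv hi; rewrite /avoiding E avoids_delval. Qed.

Lemma mem_ext q (ps ps' : seq nat) : (q :: ps' \in ext ps) =
  [&& ps' == ps, q <= size ps & avoiding (q :: ps)].
Proof.
apply/mapP/and3P => [[x]|[/eqP -> hq hav]].
  by rewrite mem_filter mem_iota => /andP[h /andP[_ hx]] [-> ->].
by exists q => //; rewrite mem_filter mem_iota hav.
Qed.

Lemma nil_ext ps : ([::] \in ext ps) = false.
Proof. by apply/mapP => -[]. Qed.

Lemma mem_children q (ps ps' : seq nat) : (q :: ps' \in children ps) =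
  [&& ps' == ps, size ps < n.-1, q <= size ps & avoiding (q :: ps)].
Proof. by rewrite /children; case: ifP => // _; rewrite ?mem_ext //= andbF. Qed.

Lemma nil_children ps : ([::] \in children ps) = false.
Proof. by rewrite /children; case: ifP => // _; rewrite nil_ext. Qed.

Lemma mem_expand q (ps : seq nat) L : (q :: ps \in expand L) =
  [&& ps \in L, size ps < n.-1, q <= size ps & avoiding (q :: ps)].
Proof.
apply/flattenP/and4P => [[s /mapP[x hx ->]]|[hL hs hq ha]].
  by rewrite mem_children => /and4P[/eqP -> -> -> ->].
by exists (children ps); [exact: map_f | rewrite mem_children eqxx hs hq ha].
Qed.

Lemma nil_expand L : ([::] \in expand L) = false.
Proof. by apply/flattenP => -[s /mapP[x hx ->]]; rewrite nil_children. Qed.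

Lemma good_cons q ps : good (q :: ps) =
  [&& good ps, size ps < n.-1, q <= size ps & avoiding (q :: ps)].
Proof.
rewrite /good /=; apply/idP/idP; last first.
  by case/and4P=> /and3P[-> _ _] h -> ->; rewrite /=; lia.
case/and3P=> /andP[hq hv] ha hs; rewrite hv ha hq (avoiding_behead _ ha) /= ?hq //; lia.
Qed.

Lemma mem_descend j (sg ps : seq nat) : good sg ->
  (ps \in descend j sg) = [&& good ps, size ps == j + size sg & drop j ps == sg].
Proof.
move=> gs; elim: j ps => [|j IH] ps.
  rewrite /descend /= inE drop0 add0n; apply/eqP/and3P => [->|[_ _ /eqP]] //.
rewrite /descend iterS -/(descend j sg); case: ps => [|q ps]; first by rewrite nil_expand andbF.
rewrite mem_expand IH good_cons addSn /= eqSS.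
by case: (good ps) => //=; case: (size ps == _); case: (drop j ps == _); rewrite ?andbT ?andbF.
Qed.

Lemma uniq_children ps : uniq (children ps).
Proof.
rewrite /children; case: ifP => // _; rewrite map_inj_uniq; last by move=> x y [].
by rewrite filter_uniq // iota_uniq.
Qed.

Lemma uniq_expand L : uniq L -> uniq (expand L).
Proof.
elim: L => //= a L IH /andP[ha hL]; rewrite /expand /= cat_uniq uniq_children IH // andbT /=.
apply/hasPn => -[|q x]; first by rewrite -/(expand L) nil_expand.
rewrite -/(expand L) mem_expand => /andP[hx _]; rewrite mem_children.
by apply/negP => /andP[/eqP Ex _]; rewrite -Ex hx in ha.
Qed.

Lemma uniq_descend j ps : uniq (descend j ps).
Proof. by elim: j => //= j IH; rewrite uniq_expand. Qed.

Lemma size_children ps : size (children ps) <= n.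
Proof.
rewrite /children; case: ifP => // h; rewrite size_map size_filter.
by apply: leq_trans (count_size _ _) _; rewrite size_iota; lia.
Qed.

Lemma size_expand L : size (expand L) <= n * size L.
Proof.
elim: L => [|a L IH]; first by [].
by rewrite /expand /= size_cat mulnS leq_add // size_children.
Qed.

Lemma size_descend j ps : size (descend j ps) <= n ^ j.
Proof.
elim: j => //= j IH; apply: leq_trans (size_expand _) _.
by rewrite expnS leq_mul2l IH orbT.
Qed.

Lemma del_top_descend i j (sg ps : seq nat) : good sg -> i <= j -> ps \in descend j.+1 sg ->
  del_top i ps \in descend j sg.
Proof.
move=> gs hij; rewrite !mem_descend // => /and3P[/and3P[hv ha hn] /eqP Es /eqP Ed].
have hi : i < size ps by lia.
have [vd _] := del_top_spec hv hi.
by rewrite /good vd avoiding_del_top // size_del_top // drop_del_top // Ed eqxx andbT /=; lia.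
Qed.

Lemma avoiding_nil : pattern_set Pi -> avoiding [::].
Proof.
case/andP=> _ /allP h; apply/allP => pi /h /andP[hs _]; apply/negP => /has_hitP[u].
rewrite subseq0 => /eqP -> /order_isoP[/= E]; by rewrite -E in hs.
Qed.

Definition num_ext ps := count (fun q => avoiding (q :: ps)) (iota 0 (size ps).+1).

Lemma size_ext ps : size (ext ps) = num_ext ps.
Proof. by rewrite size_map size_filter. Qed.

Lemma size_avoiders_sum m : 0 < n -> pattern_set Pi -> m < n ->
  size (avoiders Pi m.+1) = \sum_(ps <- descend m [::]) num_ext ps.
Proof.
move=> n0 hPi hm; pose L := flatten [seq ext ps | ps <- descend m [::]].
have g0 : good [::] by rewrite /good avoiding_nil.
have Es : size L = \sum_(ps <- descend m [::]) num_ext ps.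
  rewrite /L size_flatten /shape sumnE -map_comp big_map; apply: eq_bigr => ps _.
  by rewrite /= size_ext.
have memL q (ps : seq nat) : (q :: ps \in L) =
    [&& ps \in descend m [::], q <= size ps & avoiding (q :: ps)].
  apply/flattenP/and3P => [[s /mapP[x hx ->]]|[h1 h2 h3]].
    by rewrite mem_ext => /and3P[/eqP -> -> ->].
  by exists (ext ps); [exact: map_f | rewrite mem_ext eqxx h2 h3].
have validL (ps : seq nat) : ps \in L -> valid ps && (size ps == m.+1).
  case: ps => [|q ps].
    by case/flattenP => s /mapP[x _ ->]; rewrite nil_ext.
  rewrite memL mem_descend // addn0 => /and3P[/and3P[/and3P[hv _ _] h _] /= -> _].
  by rewrite hv eqSS h.
have uL : uniq L.
  rewrite /L; elim: (descend m [::]) (uniq_descend m [::]) => //= a s IH /andP[has us].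
  rewrite cat_uniq IH // andbT map_inj_uniq ?filter_uniq ?iota_uniq //=; last by move=> x y [].
  apply/hasPn => x /flattenP[t /mapP[y hy ->]] hx; apply/negP => hx'.
  case: x hx hx' => [|q x]; first by rewrite nil_ext.
  by rewrite !mem_ext => /andP[/eqP -> _] /andP[/eqP E _]; rewrite -E hy in has.
rewrite -Es -(size_map perm_of L); apply: perm_size; apply: uniq_perm.
- by rewrite filter_uniq // permutations_uniq.
- rewrite map_inj_in_uniq // => x y /validL/andP[hx _] /validL/andP[hy _].
  exact: perm_of_inj.
move=> s; rewrite mem_filter mem_permutations; apply/andP/mapP => [[ha hs]|[ps hps ->]].
  have [ps /andP[hv /eqP Em] E] := perm_of_surj hs; exists ps => //.
  case: ps hv Em E => //= q ps /andP[hq hv] [Em] E; rewrite memL hq mem_descend // /good hv.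
  have haq : avoiding (q :: ps) by rewrite /avoiding /= E.
  by rewrite haq (avoiding_behead _ haq) /= ?hq // Em hm addn0 eqxx drop_oversize ?Em.
have /andP[hv /eqP Em] := validL ps hps; split; last by rewrite -Em; exact: perm_of_perm.
case: ps hps {hv Em} => [|q ps]; first by rewrite /= => _; exact: avoiding_nil.
by rewrite memL => /and3P[].
Qed.

Lemma size_descend_avoiders m : pattern_set Pi -> m.+1 < n ->
  size (descend m.+1 [::]) = size (avoiders Pi m.+1).
Proof.
move=> hPi hm; rewrite size_avoiders_sum //; try lia.
rewrite /descend iterS /expand size_flatten /shape sumnE -map_comp big_map.
rewrite !big_seq; apply: eq_bigr => ps.
rewrite mem_descend; last by rewrite /good avoiding_nil //=; lia.
rewrite addn0 => /and3P[_ /eqP Es _]; rewrite /= /children Es ifT ?size_ext //; lia.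
Qed.

Section Levels.
Variables (k K : nat).
Let g := K.-1.

(* Two members of a level belong to the same sublevel iff they have equal keys. *)
Definition key ps : seq nat := drop g.-1 ps.

(* For d < g the fixed avoider is the empty one. *)
Definition level d L :=
  exists2 sg, good sg && (size sg == d - g) & L = descend (minn d g) sg.

Definition grouped d (gs : seq (seq (seq nat))) :=
  [/\ forall G, G \in gs -> G != [::],
      forall G, G \in gs -> level d.+1 (expand G),
      forall G, G \in gs -> {in G &, forall x y, key x = key y}
    & uniq [seq key (head [::] G) | G <- gs]].

Lemma descend_flatten j sg : descend j.+1 sg = flatten [seq descend j c | c <- children sg].
Proof.
rewrite /descend iterSr /= /expand /= cats0; elim: (children sg) => [|c s IH] /=.
  by rewrite iter_expand_nil.
by rewrite -cat1s iter_expand_cat IH.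
Qed.

Lemma level_grouped d L : 1 < K -> level d L ->
  exists2 gs, grouped d gs & L = flatten gs.
Proof.
move=> hK [sg /andP[gsg /eqP Es] ->].
have memsz (x : seq nat) : x \in descend (minn d g) sg -> size x = d.
  by rewrite mem_descend // => /and3P[_ /eqP -> _]; lia.
have [hd|hd] := boolP (g <= d); last first.
  have Es0 : sg = [::] by apply: size0nil; lia.
  have [E|ne] := eqVneq (descend (minn d g) sg) [::]; first by exists [::] => //; rewrite E.
  exists [:: descend (minn d g) sg]; last by rewrite /= cats0.
  split=> // G; rewrite inE => /eqP -> //.
    exists [::]; first by rewrite /= -{1}Es0 gsg; lia.
    by rewrite Es0; have -> : minn d.+1 g = (minn d g).+1 by lia.
  by move=> x y /memsz hx /memsz hy; rewrite /key !drop_oversize //; lia.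
have Eg : minn d g = g.-1.+1 by lia.
have gch (c : seq nat) : c \in children sg -> good c && (size c == (size sg).+1).
  case: c => [|q c]; first by rewrite nil_children.
  by rewrite mem_children => /and4P[/eqP -> h1 h2 h3]; rewrite good_cons gsg h1 h2 h3 /=.
exists [seq G <- [seq descend g.-1 c | c <- children sg] | G != [::]]; last first.
  rewrite Eg descend_flatten; elim: (children sg) => //= c s ->.
  by case: eqP => //= ->.
have keyG c : c \in children sg -> {in descend g.-1 c, forall x, key x = c}.
  by move=> /gch/andP[gc _] x; rewrite mem_descend // => /and3P[_ _ /eqP].
split=> [G|G|G|].
- by rewrite mem_filter => /andP[].
- rewrite mem_filter => /andP[_ /mapP[c hc ->]]; exists c; last first.
    by have -> : minn d.+1 g = g.-1.+1 by lia.
  by have /andP[-> /eqP ->] := gch c hc; rewrite Es /=; lia.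
- by rewrite mem_filter => /andP[_ /mapP[c hc ->]] x y hx hy; rewrite !(keyG c).
rewrite filter_map -map_comp map_inj_in_uniq ?filter_uniq ?uniq_children //.
move=> x y; rewrite !mem_filter /= => /andP[nx hx] /andP[ny hy].
rewrite (keyG x hx) ?(keyG y hy) //.
  by case: (descend _ y) ny => //= a s _; rewrite inE eqxx.
by case: (descend _ x) nx => //= a s _; rewrite inE eqxx.
Qed.

Lemma level_mem d L (ps : seq nat) : level d L -> ps \in L -> good ps /\ size ps = d.
Proof.
case=> sg /andP[gsg /eqP Es] ->; rewrite mem_descend // => /and3P[-> /eqP -> _].
by split=> //; lia.
Qed.

Lemma level_uniq d L : level d L -> uniq L.
Proof. by case=> sg _ ->; exact: uniq_descend. Qed.

Lemma level_size d L : 0 < n -> level d L -> size L <= n ^ g.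
Proof.
move=> n0 [sg _ ->]; apply: leq_trans (size_descend _ _) _.
by rewrite leq_pexp2l // geq_minr.
Qed.

Lemma level_del_top d L i (ps : seq nat) : 0 < K -> level d L ->
  ps \in expand L -> i < minn K d.+1 -> del_top i ps \in L.
Proof.
move=> hK [sg /andP[gsg /eqP Es] ->] h hi; apply: del_top_descend => //; lia.
Qed.

Hypothesis hPi : forall pi : seq nat, pi \in Pi -> is_perm (size pi) pi /\ size pi <= k.
Hypothesis EK : K = minn k n.

Lemma avoiding_cons q ps : good ps -> q <= size ps ->
  avoiding (q :: ps) = (perm_of (q :: ps) \notin Pi) &&
    all (fun i => avoiding (unbump (nth 0 (tops ps) i) q :: del_top i ps))
        (iota 0 (minn K (size ps))).
Proof.
case/and3P=> hv ha hs hq.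
have vq : valid (q :: ps) by rewrite /= hq.
rewrite {1}/avoiding (avoids_by_deletion hPi EK (perm_of_perm (q :: ps)) hs); congr (_ && _).
have E i : i < (size ps).+1 -> avoiding (del_top i (q :: ps)) =
    avoids Pi (delval ((size ps).+1 - i) (perm_of (q :: ps))).
  by move=> hi; have [_ Ed] := @del_top_spec i (q :: ps) vq hi; rewrite /avoiding Ed.
rewrite -[iota 0 _.+1]/(0 :: iota (1 + 0) (minn K (size ps))) iotaDl.
rewrite [LHS]/= all_map -E // [avoiding _]/= ha /=.
apply: eq_in_all => i; rewrite mem_iota /= => hi; rewrite -E //; lia.
Qed.

Lemma long_perm_notin q ps : K <= size ps -> size ps < n -> perm_of (q :: ps) \notin Pi.
Proof.
move=> hK hs; apply/negP => /hPi[_]; rewrite size_perm_of /=; lia.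
Qed.

End Levels.
End Tree.

(** * Weakest preconditions *)

Notation hash_table := {fmap nat * nat -> nat}.
Definition get (T : hash_table) (h c : nat) : nat := odflt 0 T.[? (h, c)]%fmap.

Section WP.
Variables (w S : nat).
Implicit Types (p : prog) (Q : nat -> state -> Prop) (s : state).

Definition wp p Q s := exists t q s', [/\ exec w p s t q s', q <= S & Q t s'].

Lemma wp_mono p Q Q' s : wp p Q s -> (forall t s', Q t s' -> Q' t s') -> wp p Q' s.
Proof. by move=> [t [q [s' [h1 h2 h3]]]] h; exists t, q, s'; split; auto. Qed.

Lemma wp_seq p1 p2 Q s :
  wp p1 (fun t1 s1 => wp p2 (fun t2 => Q (t1 + t2)) s1) s -> wp (Seq p1 p2) Q s.
Proof.
move=> [t1 [q1 [s1 [h1 hq1 [t2 [q2 [s2 [h2 hq2 hQ]]]]]]]].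
exists (t1 + t2), (maxn q1 q2), s2; split=> //; first exact: ExecSeq h1 h2.
by rewrite geq_max hq1 hq2.
Qed.

Lemma wp_if r p1 p2 Q s :
  wp (if regs s r != 0 then p1 else p2) (fun t => Q t.+1) s -> wp (If r p1 p2) Q s.
Proof.
case: eqP => /= [E|/eqP E] [t [q [s' [h1 h2 h3]]]]; exists t.+1, q, s'; split=> //.
  exact: ExecIfF.
exact: ExecIfT.
Qed.

Lemma wp_ifT r p1 p2 Q s : regs s r != 0 -> wp p1 (fun t => Q t.+1) s ->
  wp (If r p1 p2) Q s.
Proof. by move=> h hp; apply: wp_if; rewrite h. Qed.

Lemma wp_ifF r p1 p2 Q s : regs s r = 0 -> wp p2 (fun t => Q t.+1) s ->
  wp (If r p1 p2) Q s.
Proof. by move=> h hp; apply: wp_if; rewrite h. Qed.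

Lemma wp_whileF r p Q s : regs s r = 0 -> space s <= S -> Q 1 s -> wp (While r p) Q s.
Proof. by move=> E hs hQ; exists 1, (space s), s; split=> //; exact: ExecWhileF. Qed.

Lemma wp_whileT r p Q s : regs s r != 0 ->
  wp p (fun t1 s1 => wp (While r p) (fun t2 => Q (t1 + t2).+1) s1) s ->
  wp (While r p) Q s.
Proof.
move=> E [t1 [q1 [s1 [h1 hq1 [t2 [q2 [s2 [h2 hq2 hQ]]]]]]]].
exists (t1 + t2).+1, (maxn q1 q2), s2; split=> //; first exact: ExecWhileT h1 h2.
by rewrite geq_max hq1 hq2.
Qed.

Lemma wp_for r p (c : nat -> nat) N (Inv : nat -> state -> Prop) s :
  (forall j s, j < N -> Inv j s ->
     regs s r != 0 /\ wp p (fun t s' => t <= c j /\ Inv j.+1 s') s) ->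
  (forall s, Inv N s -> regs s r = 0 /\ space s <= S) ->
  Inv 0 s ->
  wp (While r p) (fun t s' => t <= (\sum_(j < N) (c j).+1).+1 /\ Inv N s') s.
Proof.
elim: N c Inv s => [|N IH] c Inv s hstep hend h0.
  by have [h1 h2] := hend s h0; apply: wp_whileF; rewrite ?big_ord0.
have [h1 h2] := hstep 0 s isT h0; apply: wp_whileT => //.
apply: wp_mono h2 _ => t1 s1 [ht1 hI1].
apply: wp_mono (IH (fun j => c j.+1) (fun j => Inv j.+1) s1 _ hend hI1) _.
  by move=> j s' hj; exact: (hstep j.+1).
move=> t2 s2 [ht2 hI2]; split=> //; rewrite big_ord_recl.
by rewrite addSn ltnS -addnS leq_add.
Qed.

Lemma wp_const r c Q s : c < 2 ^ w -> space s <= S ->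
  Q 1 (set_reg s r c) -> wp (Do (Const r c)) Q s.
Proof.
move=> hc hs hQ; exists 1, (maxn (space s) (space s)), (set_reg s r c).
have -> : set_reg s r c = exec_instr w (Const r c) s by rewrite /= modn_small.
by split; [exact: ExecDo | rewrite maxnn | rewrite /= modn_small].
Qed.

Lemma wp_un o r x a v Q s : regs s x = a -> eval_unop w o a = v -> space s <= S ->
  Q 1 (set_reg s r v) -> wp (Do (Un o r x)) Q s.
Proof.
move=> <- <- hs hQ; exists 1, (maxn (space s) (space s)), (exec_instr w (Un o r x) s).
by split=> //; [exact: ExecDo | rewrite maxnn].
Qed.

Lemma wp_bin o r x y a c v Q s : regs s x = a -> regs s y = c ->
  eval_binop w o a c = v -> space s <= S ->
  Q 1 (set_reg s r v) -> wp (Do (Bin o r x y)) Q s.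
Proof.
move=> <- <- <- hs hQ; exists 1, (maxn (space s) (space s)), (exec_instr w (Bin o r x y) s).
by split=> //; [exact: ExecDo | rewrite maxnn].
Qed.

Lemma wp_add r x y a c Q s : regs s x = a -> regs s y = c -> a + c < 2 ^ w ->
  space s <= S -> Q 1 (set_reg s r (a + c)) -> wp (Do (Bin OpAdd r x y)) Q s.
Proof. by move=> h1 h2 h; apply: wp_bin h1 h2 _; rewrite /= modn_small. Qed.

Lemma wp_sub r x y a c Q s : regs s x = a -> regs s y = c -> c <= a < 2 ^ w ->
  space s <= S -> Q 1 (set_reg s r (a - c)) -> wp (Do (Bin OpSub r x y)) Q s.
Proof.
move=> h1 h2 /andP[h h']; apply: wp_bin h1 h2 _; rewrite /=.
by rewrite -addnBAC // modnDr modn_small //; lia.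
Qed.

Lemma wp_mul r x y a c Q s : regs s x = a -> regs s y = c -> a * c < 2 ^ w ->
  space s <= S -> Q 1 (set_reg s r (a * c)) -> wp (Do (Bin OpMul r x y)) Q s.
Proof. by move=> h1 h2 h; apply: wp_bin h1 h2 _; rewrite /= modn_small. Qed.

Lemma wp_shl r x y a c Q s : regs s x = a -> regs s y = c -> a * 2 ^ c < 2 ^ w ->
  space s <= S -> Q 1 (set_reg s r (a * 2 ^ c)) -> wp (Do (Bin OpShl r x y)) Q s.
Proof. by move=> h1 h2 h; apply: wp_bin h1 h2 _; rewrite /= modn_small. Qed.

Lemma wp_shr r x y a c Q s : regs s x = a -> regs s y = c ->
  space s <= S -> Q 1 (set_reg s r (a %/ 2 ^ c)) -> wp (Do (Bin OpShr r x y)) Q s.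
Proof. by move=> h1 h2; apply: wp_bin h1 h2 _. Qed.

Lemma wp_mod r x y a c Q s : regs s x = a -> regs s y = c ->
  space s <= S -> Q 1 (set_reg s r (a %% c)) -> wp (Do (Bin OpMod r x y)) Q s.
Proof. by move=> h1 h2; apply: wp_bin h1 h2 _. Qed.

Lemma wp_lt r x y a c Q s : regs s x = a -> regs s y = c ->
  space s <= S -> Q 1 (set_reg s r (a < c)) -> wp (Do (Bin OpLt r x y)) Q s.
Proof. by move=> h1 h2; apply: wp_bin h1 h2 _. Qed.

Lemma wp_eq r x y a c Q s : regs s x = a -> regs s y = c ->
  space s <= S -> Q 1 (set_reg s r (a == c)) -> wp (Do (Bin OpEq r x y)) Q s.
Proof. by move=> h1 h2; apply: wp_bin h1 h2 _. Qed.

Lemma wp_and r x y a c Q s : regs s x = a -> regs s y = c ->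
  space s <= S -> Q 1 (set_reg s r (Nat.land a c)) -> wp (Do (Bin OpAnd r x y)) Q s.
Proof. by move=> h1 h2; apply: wp_bin h1 h2 _. Qed.

Lemma wp_hmem h r key a Q s : regs s key = a -> space s <= S ->
  Q 1 (set_reg s r ((h, a) \in domf (table s))) -> wp (Do (HMem h r key)) Q s.
Proof.
move=> <- hs hQ; exists 1, (maxn (space s) (space s)), (exec_instr w (HMem h r key) s).
by split=> //; [exact: ExecDo | rewrite maxnn].
Qed.

Lemma wp_hget h r key a v Q s : regs s key = a -> get (table s) h a = v -> space s <= S ->
  Q 1 (set_reg s r v) -> wp (Do (HGet h r key)) Q s.
Proof.
move=> <- <- hs hQ; exists 1, (maxn (space s) (space s)), (exec_instr w (HGet h r key) s).
by split=> //; [exact: ExecDo | rewrite maxnn].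
Qed.

Lemma wp_hinsert h key x a v Q s : regs s key = a -> regs s x = v -> space s <= S ->
  space (set_table s (table s).[(h, a) <- v]%fmap) <= S ->
  Q 1 (set_table s (table s).[(h, a) <- v]%fmap) -> wp (Do (HInsert h key x)) Q s.
Proof.
move=> <- <- hs hs' hQ; set s' := set_table _ _ in hs' hQ.
exists 1, (maxn (space s) (space s')), s'.
by split=> //; [exact: (ExecDo w (HInsert h key x)) | rewrite geq_max hs].
Qed.

Lemma wp_hdelete h key a Q s : regs s key = a -> space s <= S ->
  space (set_table s (table s).[~ (h, a)]%fmap) <= S ->
  Q 1 (set_table s (table s).[~ (h, a)]%fmap) -> wp (Do (HDelete h key)) Q s.
Proof.
move=> <- hs hs' hQ; set s' := set_table _ _ in hs' hQ.
exists 1, (maxn (space s) (space s')), s'.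
by split=> //; [exact: (ExecDo w (HDelete h key)) | rewrite geq_max hs].
Qed.

Lemma touch_id s a : a < top s -> touch s a = s.
Proof. by case: s => rf m T tp /= h; rewrite /touch /=; congr State; lia. Qed.

Lemma wp_read r x a v Q s : regs s x = a -> memory s a = v -> a < top s ->
  space s <= S -> Q 1 (set_reg s r v) -> wp (Do (Read r x)) Q s.
Proof.
move=> Ea <- ha hs hQ; exists 1, (maxn (space s) (space s)), (set_reg s r (memory s a)).
have E : exec_instr w (Read r x) s = set_reg s r (memory s a).
  by rewrite /= Ea touch_id.
split=> //; last by rewrite maxnn.
by have := ExecDo w (Read r x) s; rewrite E.
Qed.

Lemma wp_write x y a v Q s : regs s x = a -> regs s y = v -> a < top s ->
  space s <= S -> Q 1 (set_mem s a v) -> wp (Do (Write x y)) Q s.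
Proof.
move=> Ea Ev ha hs hQ; exists 1, (maxn (space s) (space s)), (set_mem s a v).
have E : exec_instr w (Write x y) s = set_mem s a v by rewrite /= Ea Ev touch_id.
split=> //; last by rewrite maxnn.
by have := ExecDo w (Write x y) s; rewrite E.
Qed.

End WP.

(** * The program *)

(* Registers: 0-2 the input n, K, b; 3 and 4 the constants 1 and 0; 5 and 6 the
   values b (K - 2) and n - 1; 7 the length of the avoiders being created;
   8 the height of the stack of records; 9 the record being extended; 10 and 11
   the end of its level and its key; 14 its length; 16-19 its code, insertion
   sequence, top positions and remaining bitmap; 20 the insertion position;
   23-26 the code, insertion sequence, bitmap and top positions of the new
   avoider.
   Tables: 0 the patterns; 1 the bitmap of every live code; 2-4 the stack of
   records (code, insertion sequence, positions of the K largest letters);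
   5 and 6 the first record of each level and its next one to be extended. *)

Notation "p ;; q" := (Seq p q) (at level 60, right associativity).

Definition pattern_body : prog :=
  Do (Bin OpShl 53 3 51) ;;
  Do (Bin OpMod 54 23 53) ;;
  Do (Bin OpShl 55 27 51) ;;
  Do (Bin OpShr 56 23 51) ;;
  Do (Bin OpAdd 57 51 2) ;;
  Do (Bin OpShl 56 56 57) ;;
  Do (Bin OpAdd 54 54 55) ;;
  Do (Bin OpAdd 54 54 56) ;;
  Do (HMem 0 58 54) ;;
  Do (Bin OpSub 58 3 58) ;;
  Do (Bin OpShl 58 58 50) ;;
  Do (Bin OpAdd 25 25 58) ;;
  Do (Bin OpAdd 50 50 3) ;;
  Do (Bin OpAdd 51 51 2) ;;
  Do (Bin OpLt 52 50 27).

Definition deletion_body : prog :=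
  Do (Bin OpMul 37 2 32) ;;
  Do (Bin OpShl 38 3 37) ;;
  Do (Bin OpSub 30 30 38) ;;
  Do (Bin OpMod 39 30 38) ;;
  Do (Bin OpAdd 40 37 2) ;;
  Do (Bin OpShr 41 30 40) ;;
  Do (Bin OpShl 41 41 37) ;;
  Do (Bin OpAdd 39 39 41) ;;
  Do (HGet 1 42 39) ;;
  Do (Bin OpAdd 43 32 3) ;;
  Do (Bin OpShl 44 3 43) ;;
  Do (Bin OpMod 44 42 44) ;;
  Do (Bin OpShr 45 42 32) ;;
  Do (Bin OpShl 45 45 43) ;;
  Do (Bin OpAdd 44 44 45) ;;
  Do (Bin OpAnd 25 25 44) ;;
  Do (Bin OpShl 46 32 33) ;;
  Do (Bin OpAdd 26 26 46) ;;
  Do (Bin OpAdd 33 33 2) ;;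
  Do (Bin OpShl 47 3 2) ;;
  Do (Bin OpMod 32 34 47) ;;
  Do (Bin OpShr 34 34 2) ;;
  Do (Bin OpLt 48 32 20) ;;
  Do (Bin OpSub 48 3 48) ;;
  Do (Bin OpAdd 32 32 48) ;;
  Do (Bin OpAdd 31 31 3) ;;
  Do (Bin OpLt 35 31 36).

Lemma regs_eq s r v : regs (set_reg s r v) r = v.
Proof. by rewrite /= eqxx. Qed.

Lemma regs_ne s r x v : (x == r) = false -> regs (set_reg s r v) x = regs s x.
Proof. by move=> /= ->. Qed.

Lemma regs_low B x : x < B -> forall s r v, B <= r ->
  regs (set_reg s r v) x = regs s x.
Proof. by move=> hx s r v hr; apply: regs_ne; lia. Qed.

Lemma regs_table s T x : regs (set_table s T) x = regs s x.
Proof. by []. Qed.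

Lemma regs_mem s a v x : regs (set_mem s a v) x = regs s x.
Proof. by []. Qed.

Ltac lookup := lazymatch goal with
  | |- regs (set_reg ?s ?r ?v) ?x = _ =>
      let e := eval vm_compute in (x == r) in
      lazymatch e with
      | true => exact (regs_eq s r v)
      | false => refine (etrans (@regs_ne s r x v (erefl false)) _); lookup
      end
  | |- regs (set_table ?s ?T) ?x = _ => refine (etrans (regs_table s T x) _); lookup
  | |- regs (set_mem ?s ?a ?v) ?x = _ => refine (etrans (regs_mem s a v x) _); lookup
  | |- regs ?s ?x = _ =>
      first [ eassumption
            | match goal with H : forall r, is_true _ -> regs s r = regs _ r |- _ =>
                refine (etrans (H x isT) _); lookup end ]
  end.

Ltac lookup_to := eapply etrans; [lookup|].

Lemma space_set s r v S : space s <= S -> space (set_reg s r v) <= S.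
Proof. by []. Qed.

Lemma space_set_mem s a v S : space s <= S -> space (set_mem s a v) <= S.
Proof. by []. Qed.

Ltac space_tac := lazymatch goal with
  | |- is_true (space (set_reg _ _ _) <= _) => apply space_set; space_tac
  | |- is_true (space (set_mem _ _ _) <= _) => apply space_set_mem; space_tac
  | |- is_true (space ?s <= _) =>
      try match goal with H : is_true (space s <= _) |- _ => exact H end
  end.

Ltac run_instr :=
  lazymatch goal with
  | |- wp _ _ (Do (Const _ _)) _ _ => apply: wp_const; [ |space_tac| ]
  | |- wp _ _ (Do (Bin OpAdd _ _ _)) _ _ => eapply wp_add; [lookup|lookup| |space_tac| ]
  | |- wp _ _ (Do (Bin OpSub _ _ _)) _ _ => eapply wp_sub; [lookup|lookup| |space_tac| ]
  | |- wp _ _ (Do (Bin OpMul _ _ _)) _ _ => eapply wp_mul; [lookup|lookup| |space_tac| ]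
  | |- wp _ _ (Do (Bin OpShl _ _ _)) _ _ => eapply wp_shl; [lookup|lookup| |space_tac| ]
  | |- wp _ _ (Do (Bin OpShr _ _ _)) _ _ => eapply wp_shr; [lookup|lookup|space_tac| ]
  | |- wp _ _ (Do (Bin OpMod _ _ _)) _ _ => eapply wp_mod; [lookup|lookup|space_tac| ]
  | |- wp _ _ (Do (Bin OpLt _ _ _)) _ _ => eapply wp_lt; [lookup|lookup|space_tac| ]
  | |- wp _ _ (Do (Bin OpEq _ _ _)) _ _ => eapply wp_eq; [lookup|lookup|space_tac| ]
  | |- wp _ _ (Do (Bin OpAnd _ _ _)) _ _ => eapply wp_and; [lookup|lookup|space_tac| ]
  | |- wp _ _ (Do (Un _ _ _)) _ _ => eapply wp_un; [lookup| |space_tac| ]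
  | |- wp _ _ (Do (HMem _ _ _)) _ _ => eapply wp_hmem; [lookup|space_tac| ]
  | |- wp _ _ (Do (HGet _ _ _)) _ _ => eapply wp_hget; [lookup| |space_tac| ]
  | |- wp _ _ (Do (HInsert _ _ _)) _ _ => eapply wp_hinsert; [lookup|lookup|try space_tac| | ]
  | |- wp _ _ (Do (HDelete _ _)) _ _ => eapply wp_hdelete; [lookup|try space_tac| | ]
  | |- wp _ _ (Do (Read _ _)) _ _ => eapply wp_read; [lookup| | |space_tac| ]
  | |- wp _ _ (Do (Write _ _)) _ _ => eapply wp_write; [lookup|lookup| |space_tac| ]
  end.

Ltac run :=
  lazymatch goal with
  | |- wp _ _ (Seq _ _) _ _ => apply wp_seq; run_instr; cbv beta
  | |- _ => run_instr; cbv beta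
  end.

Definition frame (F : pred nat) (s s' : state) :=
  [/\ memory s' = memory s, table s' = table s, top s' = top s
    & forall r, F r -> regs s' r = regs s r].

Lemma frame_space F s s' : frame F s s' -> space s' = space s.
Proof. by case=> _ Et Etop _; rewrite /space Et Etop. Qed.

Lemma frame_set F s s' r v : ~~ F r -> frame F s s' -> frame F s (set_reg s' r v).
Proof.
move=> hr [h1 h2 h3 h4]; split=> // x hx; rewrite regs_ne ?h4 //.
by apply: contraNF hr => /eqP <-.
Qed.

Lemma sum3_lt W x a c d : x = a + c + d -> x < W -> [/\ c < W, d < W & a + c < W].
Proof. by split; lia. Qed.

Definition pattern_prog : prog :=
  If 29
    (Do (Const 25 0) ;; Do (Const 50 0) ;; Do (Const 51 0) ;; Do (Const 52 1) ;;
     Do (Bin OpAdd 36 7 4) ;; While 52 pattern_body)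
    (Do (Bin OpShl 25 3 27) ;; Do (Bin OpSub 25 25 3) ;; Do (Bin OpAdd 36 1 4)).

Definition child : prog :=
  Do (Bin OpMul 22 2 20) ;;
  Do (Bin OpShl 21 3 22) ;;
  Do (Bin OpMod 23 16 21) ;;
  Do (Bin OpShl 24 7 22) ;;
  Do (Bin OpAdd 23 23 24) ;;
  Do (Bin OpShr 24 16 22) ;;
  Do (Bin OpAdd 21 22 2) ;;
  Do (Bin OpShl 24 24 21) ;;
  Do (Bin OpAdd 23 23 24) ;;
  Do (Bin OpShl 24 17 2) ;;
  Do (Bin OpAdd 24 24 20) ;;
  Do (Bin OpAdd 27 7 3) ;;
  Do (Bin OpLt 29 7 1) ;;
  pattern_prog ;;
  Do (Bin OpAdd 30 23 4) ;;
  Do (Const 31 0) ;;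
  Do (Bin OpAdd 32 20 4) ;;
  Do (Const 33 0) ;;
  Do (Bin OpAdd 34 18 4) ;;
  Do (Const 26 0) ;;
  Do (Const 35 1) ;;
  While 35 deletion_body ;;
  Do (Un OpPopcount 28 25) ;;
  Do (Read 29 27) ;;
  Do (Bin OpAdd 29 29 28) ;;
  Do (Write 27 29) ;;
  Do (Bin OpLt 28 7 6) ;;
  Do (Bin OpMul 25 25 28) ;;
  Do (HInsert 1 23 25) ;;
  Do (HInsert 2 8 23) ;;
  Do (HInsert 3 8 24) ;;
  Do (HInsert 4 8 26) ;;
  Do (Bin OpAdd 8 8 3).

Lemma get_set (T : hash_table) h c h' c' v :
  get T.[(h, c) <- v]%fmap h' c' = if (h' == h) && (c' == c) then v else get T h' c'.
Proof. by rewrite /get fnd_set xpair_eqE; case: ifP. Qed.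

Lemma get_rem (T : hash_table) h c h' c' : ~~ ((h' == h) && (c' == c)) ->
  get T.[~ (h, c)]%fmap h' c' = get T h' c'.
Proof. by move=> hne; rewrite /get fnd_rem1 xpair_eqE hne. Qed.

Definition bits_body : prog :=
  Do (Un OpCtz 20 19) ;; Do (Bin OpShl 21 3 20) ;; Do (Bin OpSub 19 19 21) ;; child.

Definition rec_body : prog :=
  Do (HGet 2 16 9) ;; Do (HGet 3 17 9) ;; Do (HGet 4 18 9) ;; Do (HGet 1 19 16) ;;
  While 19 bits_body ;;
  Do (Bin OpAdd 9 9 3) ;;
  Do (Bin OpLt 12 9 10) ;;
  Do (HGet 3 13 9) ;; Do (Bin OpShr 13 13 5) ;; Do (Bin OpEq 13 13 11) ;;
  Do (Bin OpMul 12 12 13).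

Definition push_prog : prog :=
  Do (Bin OpAdd 10 8 4) ;;
  Do (HGet 3 11 9) ;; Do (Bin OpShr 11 11 5) ;;
  Do (Const 12 1) ;;
  While 12 rec_body ;;
  Do (HInsert 6 14 9) ;; Do (HInsert 5 7 10) ;; Do (HInsert 6 7 10) ;;
  Do (Bin OpAdd 7 7 3).

Definition pop_body : prog :=
  Do (Bin OpSub 8 8 3) ;; Do (HGet 2 16 8) ;; Do (HDelete 1 16) ;;
  Do (Bin OpLt 12 10 8).

Definition pop_prog : prog :=
  Do (HGet 5 10 14) ;; Do (Bin OpLt 12 10 8) ;; While 12 pop_body ;;
  Do (Bin OpAdd 7 14 4).

Definition main_body : prog :=
  Do (Bin OpSub 14 7 3) ;; Do (HGet 6 9 14) ;; Do (Bin OpLt 13 9 8) ;;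
  If 13 push_prog pop_prog.

Definition loop_prog : prog :=
  Do (Const 12 2) ;; Do (Bin OpSub 5 1 12) ;; Do (Bin OpMul 5 2 5) ;;
  Do (Bin OpSub 6 0 3) ;;
  Do (HInsert 1 4 3) ;; Do (HInsert 2 4 4) ;; Do (HInsert 3 4 4) ;;
  Do (HInsert 4 4 4) ;; Do (HInsert 5 4 4) ;; Do (HInsert 6 4 4) ;;
  Do (Const 8 1) ;; Do (Const 7 1) ;; While 7 main_body.

Definition count_prog : prog :=
  Do (Const 3 1) ;; Do (HMem 0 13 3) ;; Do (Bin OpSub 13 3 13) ;;
  Do (Write 3 13) ;; Do (Bin OpLt 14 3 0) ;; Do (Bin OpMul 13 13 14) ;;
  If 13 loop_prog (Do (Const 13 0)).

Lemma fact_leq_exp m n : m <= n -> m`! <= n ^ m.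
Proof.
by elim: m => // m IH h; rewrite factS expnS leq_mul // IH // ltnW.
Qed.

Lemma sum_fact m : \sum_(i <- iota 1 m) i`! <= 2 * m`!.
Proof.
elim: m => [|m IH]; first by rewrite big_nil.
rewrite -[X in iota 1 X]addn1 iotaD big_cat /= big_seq1 add1n.
case: m IH => [|m] IH; first by rewrite big_nil.
apply: leq_trans (leq_add IH (leqnn _)) _.
by rewrite [2 * (m.+2)`!]mul2n -addnn leq_add2r [X in _ <= X]factS leq_mul2r; apply/orP; right.
Qed.

(** * Verification *)

Lemma mem_pattern_table b n Pi (x : nat * nat) : (x \in domf (pattern_table b n Pi)) =
  has (fun pi => (size pi <= n) && (x == (0, encode b pi))) Pi.
Proof.
rewrite /pattern_table; set F := (X in foldr X _ _).
have FE pi T : domf (F pi T) = ((0, encode b pi) |` domf T)%fset by exact: dom_setf.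
clearbody F; elim: Pi => [|pi s IH]; first by rewrite in_fset0.
by rewrite [filter _ _]/= /=; case: ifP => h //=; rewrite FE in_fset1U IH.
Qed.

Lemma card_pattern_table Pi k n b :
  (forall pi : seq nat, pi \in Pi -> is_perm (size pi) pi /\ size pi <= k) ->
  (forall pi : seq nat, pi \in Pi -> 0 < size pi) -> 0 < n ->
  (forall x, x \in domf (pattern_table b n Pi) -> x.1 = 0) /\
  #|` domf (pattern_table b n Pi)|%fset <= 2 * n ^ k.
Proof.
move=> hPi hpos n0.
split; first by move=> x; rewrite mem_pattern_table => /hasP[pi _ /andP[_ /eqP ->]].
pose K := minn k n.
pose l := [seq (0, encode b s) | s <- flatten [seq permutations (iota 1 m) | m <- iota 1 K]].
have sub : {subset domf (pattern_table b n Pi) <= l}.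
  move=> x; rewrite mem_pattern_table => /hasP[pi hpi /andP[hn /eqP ->]]; apply: map_f.
  apply/flattenP; exists (permutations (iota 1 (size pi))).
    by apply: map_f; have [_ hk] := hPi pi hpi; rewrite mem_iota add1n ltnS leq_min hk hn hpos.
  by rewrite mem_permutations; have [] := hPi pi hpi.
apply: leq_trans (uniq_leq_size (fset_uniq _) sub) _.
rewrite size_map size_flatten /shape sumnE -map_comp big_map.
have -> : \sum_(j <- iota 1 K) (size \o (fun m => permutations (iota 1 m))) j
    = \sum_(j <- iota 1 K) j`!.
  by apply: eq_bigr => j _; rewrite /= size_permutations ?iota_uniq // size_iota.
apply: leq_trans (sum_fact K) _; rewrite leq_mul2l /=.
apply: leq_trans (fact_leq_exp (geq_minr k n)) _.
by rewrite leq_pexp2l // geq_minl.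
Qed.

Section Algorithm.
Variables (Pi : seq (seq nat)) (k n b w : nat).
Hypothesis hPi : forall pi : seq nat, pi \in Pi -> is_perm (size pi) pi /\ size pi <= k.
Hypothesis n0 : 0 < n.
Hypothesis nb : n < 2 ^ b.
Hypothesis hw : 4 * (n * b) <= w.

Local Notation K := (minn k n).
Local Notation g := (minn k n).-1.
Local Notation ptab := (pattern_table b n Pi).
Local Notation good := (good Pi n).
Local Notation children := (children Pi n).
Local Notation expand := (expand Pi n).
Local Notation descend := (descend Pi n).
Local Notation num_ext := (num_ext Pi).
Local Notation avoiding := (avoiding Pi).
Local Notation level := (level Pi n K).
Local Notation grouped := (grouped Pi n K).
Local Notation key := (key K).

(* The stack holds at most one level for each of the lengths 0, ..., n. *)
Definition height := n.+1 * n ^ K.-1.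
Definition space_bound := n.+1 + 2 * (#|` domf ptab|%fset + 4 * height + 2 * n.+1).
Local Notation S := space_bound.

Definition code ps := encode b (perm_of ps).

Lemma b_gt0 : 0 < b.
Proof. by case: b nb; rewrite // expn0; lia. Qed.

Lemma pow_lt_word e : e <= 2 * (b * n) -> 2 ^ e < 2 ^ w.
Proof. by move=> he; rewrite ltn_exp2l //; have := b_gt0; nia. Qed.

Lemma one_lt_word : 1 < 2 ^ w.
Proof. exact: (@pow_lt_word 0 (leq0n _)). Qed.

Lemma lin_lt_word x : x <= 2 * (b * n) -> x < 2 ^ w.
Proof. by move=> h; apply: ltn_trans (ltn_expl _ (isT : 1 < 2)) (pow_lt_word h). Qed.

Lemma leq_bMD_2bn x : x <= n -> b * x + b <= 2 * (b * n).
Proof. by move=> h; rewrite mul2n -addnn leq_add ?leq_pmulr // leq_mul2l h orbT. Qed.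

Lemma leq_bM_2bn x : x <= n -> b * x <= 2 * (b * n).
Proof. by move/leq_bMD_2bn; apply: leq_trans; rewrite leq_addr. Qed.

Lemma leq_S_2bn x : x <= n -> x + 1 <= 2 * (b * n).
Proof. by move=> h; have := b_gt0; nia. Qed.

Lemma le_n_lt_word x : x <= n -> x < 2 ^ w.
Proof. by move/leq_S_2bn=> h; apply: lin_lt_word; apply: leq_trans (leq_addr 1 x) h. Qed.

Lemma lt_word x : x <= 2 ^ (2 * (b * n)) -> x < 2 ^ w.
Proof. by move=> h; apply: leq_ltn_trans h (pow_lt_word _). Qed.

Lemma encode_lt_word (s : seq nat) : small b s -> size s <= n -> encode b s < 2 ^ w.
Proof.
move=> hs hn; apply: lt_word; apply: leq_trans (ltnW (encode_lt hs)) _.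
by rewrite leq_exp2l //; nia.
Qed.

Lemma code_in_pattern_table m t : is_perm m t -> m <= n ->
  ((0, encode b t) \in domf (pattern_table b n Pi)) = (t \in Pi).
Proof.
move=> ht hm; rewrite mem_pattern_table.
have sz m' u : is_perm m' u -> size u = m' by move/perm_size ->; rewrite size_iota.
have sm m' u : is_perm m' u -> m' <= n -> small b u /\ 0 \notin u.
  move=> hu hm'; split; last by rewrite (perm_mem hu) mem_iota.
  by apply/allP => x; rewrite (perm_mem hu) mem_iota; lia.
apply/hasP/idP => [[pi hpi /andP[hs /eqP[E]]]|hin].
  have [hp _] := hPi hpi; have [h1 h2] := sm _ _ ht hm; have [h3 h4] := sm _ _ hp hs.
  by rewrite (encode_inj h1 h3 h2 h4 E).
by exists t => //; rewrite (sz _ _ ht) hm eqxx.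
Qed.

Definition pattern_frame r := (r < 50) && (r != 25).

Lemma wp_pattern_loop ps s : size ps < n -> space s <= S ->
  (forall c : nat, ((0, c) \in domf (table s)) = ((0, c) \in domf (pattern_table b n Pi))) ->
  regs s 2 = b -> regs s 3 = 1 -> regs s 23 = code ps -> regs s 27 = (size ps).+1 ->
  regs s 25 = 0 -> regs s 50 = 0 -> regs s 51 = 0 -> regs s 52 = 1 ->
  wp w S (While 52 pattern_body) (fun t s' => t <= 16 * (size ps).+1 + 1 /\
     (frame pattern_frame s s' /\
      regs s' 25 = bits (size ps).+1 (fun q => perm_of (q :: ps) \notin Pi))) s.
Proof.
move=> hps hsp hT r2 r3 r23 r27 r25 r50 r51 r52; set l := size ps in hps r27 *.
pose Inv j s' := [/\ frame pattern_frame s s',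
  regs s' 25 = bits j (fun q => perm_of (q :: ps) \notin Pi),
  regs s' 50 = j, regs s' 51 = b * j & regs s' 52 = (j < l.+1)].
apply: wp_mono (@wp_for w S 52 pattern_body (fun _ => 15) l.+1 Inv s _ _ _) _; last 3 first.
- by move=> s1 [hf _ _ _ ->]; rewrite ltnn (frame_space hf).
- by split; rewrite ?muln0 ?r25 /bits ?encode_nil.
- by move=> t s' [ht [h1 h2 _ _ _]]; split=> //; rewrite sum_nat_const card_ord in ht; lia.
- move=> j s1 hj [hf e25 e50 e51 e52]; rewrite e52 hj; split=> //.
  have hsp1 : space s1 <= S by rewrite (frame_space hf).
  have sm : small b (perm_of ps) by apply: small_perm_of; lia.
  have hj' : j <= size (perm_of ps) by rewrite size_perm_of.
  have sm1 : small b (ins (perm_of ps) j l.+1).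
    by apply/allP => x; rewrite (perm_mem (perm_ins _ _ _)) inE mem_perm_of -/l; lia.
  have hE := encode_ins l.+1 sm hj'; rewrite -/(code ps) in hE.
  have hlt : encode b (ins (perm_of ps) j l.+1) < 2 ^ w.
    by apply: encode_lt_word => //; rewrite size_ins size_perm_of -/l; lia.
  have [hB hC hAB] := sum3_lt hE hlt; have [_ Et _ hfr] := hf.
  have hbj : 1 * 2 ^ (b * j) < 2 ^ w by rewrite mul1n pow_lt_word // leq_bM_2bn //; lia.
  rewrite /pattern_body.
  run => //; rewrite mul1n.
  run.
  run => //.
  run.
  run; first by apply: lin_lt_word; apply: leq_bMD_2bn; lia.
  run => //.
  run => //.
  run; first by rewrite -hE.
  run.
  rewrite -hE Et hT.
  rewrite (@code_in_pattern_table (size (j :: ps)) (perm_of (j :: ps)) (perm_of_perm _)) //.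
  run; first by case: (_ \in _) => //=; exact: one_lt_word.
  have hYlt : (perm_of (j :: ps) \notin Pi) * 2 ^ j <= 2 ^ j by case: (_ \in _); rewrite ?mul1n.
  have -> : 1 - (perm_of (j :: ps) \in Pi) = (perm_of (j :: ps) \notin Pi) by case: (_ \in _).
  have hb := b_gt0.
  run.
    apply: leq_ltn_trans hYlt (pow_lt_word _).
    by apply: leq_trans (leq_addr 1 _) (leq_S_2bn _); lia.
  rewrite -/(bits j _).
  run.
    rewrite -(bits_rcons j (fun q => perm_of (q :: ps) \notin Pi)).
    by apply: ltn_trans (bits_lt _ _) (pow_lt_word _); rewrite -addn1 leq_S_2bn //; lia.
  run; first by apply/lin_lt_word/leq_S_2bn; lia.
  run; first by apply/lin_lt_word/leq_bMD_2bn; lia.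
  run.
  split=> //; split; try lookup.
  - by do !apply: frame_set.
  - by rewrite bits_rcons; lookup.
  - by rewrite -[j.+1]addn1; lookup.
  - by rewrite mulnS [b + _]addnC; lookup.
  - by rewrite -[j.+1]addn1; lookup.
Qed.

Definition deletion_frame r := [|| [&& r < 30, r != 25 & r != 26] | r == 36].

Lemma small_tops ps : valid ps -> size ps <= 2 ^ b -> small b (tops ps).
Proof.
move=> hv hs; apply/(all_nthP 0) => i; rewrite size_tops => hi.
by apply: leq_trans (nth_tops_lt hv hi) _.
Qed.

Lemma encode_take_nth i s : small b s -> i < size s ->
  encode b (take i.+1 s) = encode b (take i s) + nth 0 s i * 2 ^ (b * i).
Proof.
move=> hs hi; rewrite (take_nth 0) // -cats1 encode_cat encode_cons encode_nil.
by rewrite size_takel 1?ltnW // muln0 addn0 mulnC.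
Qed.

Lemma wp_deletion_loop p ps f s : let tau := p :: ps in let l := size tau in
  good tau -> 0 < K -> space s <= S ->
  (forall i, i < minn K l ->
     get (table s) 1 (code (del_top i tau)) = bits l (fun q => avoiding (q :: del_top i tau))) ->
  regs s 2 = b -> regs s 3 = 1 -> regs s 20 = p -> regs s 25 = bits l.+1 f ->
  regs s 26 = 0 -> regs s 30 = code tau -> regs s 31 = 0 -> regs s 32 = p ->
  regs s 33 = 0 -> regs s 34 = encode b (take K (tops ps)) -> regs s 35 = 1 ->
  regs s 36 = minn K l ->
  wp w S (While 35 deletion_body) (fun t s' => t <= 28 * K + 1 /\
     [/\ frame deletion_frame s s', regs s' 26 = encode b (take K (tops tau))
      & regs s' 25 = bits l.+1 (fun q => f q &&
         all (fun i => avoiding (unbump (nth 0 (tops tau) i) q :: del_top i tau))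
           (iota 0 (minn K l)))]) s.
Proof.
move=> tau l gtau K0 hsp hT r2 r3 r20 r25 r26 r30 r31 r32 r33 r34 r35 r36.
have /and3P[vt _ hl] := gtau; rewrite -/l in hl.
have hpn : p < n by move: (vt) (hl) => /= /andP[? _]; rewrite /l /=; lia.
set js := take K (tops ps) in r34.
pose posi i := if i is i'.+1 then bump p (nth 0 js i') else p.
have posE i : i < minn K l -> posi i = nth 0 (tops tau) i.
  case: i => [|i] //= hi; have hi' : i < size ps by move: hi; rewrite /l /=; lia.
  by rewrite (nth_map 0) ?size_tops // nth_take //; lia.
have hb := b_gt0; have nb' := nb.
have smt : small b (tops tau) by apply: small_tops => //; rewrite -/l; lia.
have smj : small b js.
  by apply: small_take; apply: small_tops; [case/andP: vt | move: hl; rewrite /l /=; lia].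
pose Inv i s' := [/\ frame deletion_frame s s',
  regs s' 25 = bits l.+1 (fun q => f q &&
    all (fun i => avoiding (unbump (nth 0 (tops tau) i) q :: del_top i tau)) (iota 0 i)),
  regs s' 26 = encode b (take i (tops tau)) /\ regs s' 30 = encode b (lowered i tau),
  regs s' 31 = i /\ regs s' 32 = posi i
  & [/\ regs s' 33 = b * i, regs s' 34 = encode b (drop i js) & regs s' 35 = (i < minn K l)]].
apply: wp_mono (@wp_for w S 35 deletion_body (fun _ => 27) (minn K l) Inv s _ _ _) _; last 3 first.
- by move=> s1 [hf _ _ _ [_ _ ->]]; rewrite ltnn (frame_space hf).
- split=> //=; rewrite ?lowered0 ?take0 ?encode_nil ?muln0 ?drop0 ?r35 //.
    by rewrite r25; apply: eq_bits => q _; rewrite andbT.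
  by split=> //; rewrite leq_min K0 /l.
- move=> t s' [ht [h1 h2 [h3 _] _ _]]; split; first by rewrite sum_nat_const card_ord in ht; lia.
  split=> //; rewrite h3; have [hKl|hKl] := leqP K l; first by [].
  by rewrite !take_oversize ?size_tops // -/l ltnW.
move=> i s1 hi [hf e25 [e26 e30] [e31 e32] [e33 e34 e35]]; rewrite e35 hi; split=> //.
have hsp1 : space s1 <= S by rewrite (frame_space hf).
have [_ Et _ hfr] := hf.
have hil : i < size tau by rewrite -/l; lia.
have hin : i <= n by rewrite -/l in hil; lia.
have hin1 : i < n by rewrite -/l in hil; lia.
rewrite posE // in e32; have hP := nth_tops_lt vt hil; rewrite -/l in hP.
set P := nth 0 (tops tau) i in e32 hP.
have hPn : P <= n by lia.
have hlb : l < 2 ^ b by lia.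
have hlb1 : l.-1 < 2 ^ b by lia.
have hln : l <= n by lia.
have hln1 : l.-1 <= n by lia.
have El := encode_lowered b vt hil; rewrite -/P in El.
have sml j : small b (lowered j tau) by exact: small_lowered.
have hPl : P < size (lowered i.+1 tau) by rewrite size_lowered.
have hD := encode_del (sml i.+1) hPl; rewrite del_lowered // -/(code _) in hD.
have [vd _] := del_top_spec vt hil.
have hDlt : code (del_top i tau) < 2 ^ w.
  apply: encode_lt_word; last by rewrite size_perm_of size_del_top.
  by apply: small_perm_of; rewrite size_del_top.
have hFlt : encode b (lowered i tau) < 2 ^ w.
  by apply: encode_lt_word => //; rewrite size_lowered.
have hlook : get (table s1) 1 (code (del_top i tau)) =
    bits l (fun q => avoiding (q :: del_top i tau)).
  by rewrite Et hT.
have hM := bits_expand (fun q => avoiding (q :: del_top i tau)) hP.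
have hMlt : bits l.+1 (fun q => avoiding (unbump P q :: del_top i tau)) < 2 ^ w.
  by apply: ltn_trans (bits_lt _ _) (pow_lt_word _); rewrite -addn1 leq_S_2bn.
have hI := encode_take_nth smt; have {hI} := hI i; rewrite size_tops => /(_ hil) hI.
rewrite -/P in hI.
have hIlt : encode b (take i.+1 (tops tau)) < 2 ^ w.
  by apply: encode_lt_word; rewrite ?small_take // size_takel ?size_tops.
rewrite /deletion_body.
run; first by apply/lin_lt_word/leq_bM_2bn.
run; first by rewrite mul1n pow_lt_word // leq_bM_2bn.
rewrite mul1n; run; first by rewrite El leq_addl -El hFlt.
rewrite El addnK; run.
run; first by apply/lin_lt_word/leq_bMD_2bn.
run.
run; first by exact: leq_ltn_trans (leq_addl _ _) (eq_ind _ (fun x => x < _) hDlt _ hD).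
run; first by rewrite -hD.
rewrite -hD; run; first exact: hlook.
run; first by apply/lin_lt_word/leq_S_2bn.
run; first by rewrite mul1n pow_lt_word // leq_S_2bn.
rewrite mul1n addn1; run.
run.
run; first by exact: leq_ltn_trans (leq_addl _ _) (eq_ind_r (fun x => x < _) hMlt hM).
run; first by rewrite hM.
rewrite hM; run; rewrite land_bits.
run; first by exact: leq_ltn_trans (leq_addl _ _) (eq_ind _ (fun x => x < _) hIlt _ hI).
run; first by rewrite -hI.
rewrite -hI; run; first by apply/lin_lt_word/leq_bMD_2bn.
run; first by rewrite mul1n pow_lt_word //; apply: leq_trans (leq_addl _ _) (leq_bMD_2bn (leq0n _)).
rewrite mul1n; run.
rewrite encode_head ?small_drop // nth_drop addn0.
run.
have -> : encode b (drop i js) %/ 2 ^ b = encode b (drop i.+1 js).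
  by rewrite -[in 2 ^ b](muln1 b) -encode_drop ?small_drop // drop_drop add1n.
run.
run; first by rewrite one_lt_word andbT; case: (_ < _).
have -> : 1 - (nth 0 js i < p) = (p <= nth 0 js i) by case: ltnP.
have hjb : nth 0 js i < 2 ^ b.
  by have [h|h] := ltnP i (size js); [exact: (all_nthP 0 smj) | rewrite nth_default ?expn_gt0].
run.
  apply: leq_ltn_trans (_ : 2 ^ b < _); last first.
    by apply: pow_lt_word; apply: leq_trans (leq_addl _ _) (leq_bMD_2bn (leq0n _)).
  by case: (p <= _) => /=; lia.
run; first by apply/lin_lt_word/leq_S_2bn.
run.
split=> //; split.
- by do !(apply: frame_set => //).
- lookup_to; apply: eq_bits => q _.
  by rewrite -[i.+1]addn1 iotaD all_cat /= andbT andbA.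
- by split; lookup.
- by split; [rewrite -[i.+1]addn1; lookup | rewrite /posi; lookup_to; rewrite addnC].
- by split; [rewrite mulnS [b + _]addnC; lookup | lookup | rewrite -[i.+1]addn1; lookup].
Qed.

Section Search.
Hypothesis K1 : 1 < K.

Definition bitmap ps :=
  if size ps < n.-1 then bits (size ps).+1 (fun q => avoiding (q :: ps)) else 0.

Definition allowed (R : seq (seq nat)) (x : nat * nat) : bool :=
  match x.1 with
  | 0 => x \in domf ptab
  | 1 => x.2 \in [seq code ps | ps <- R]
  | 2 | 3 | 4 => x.2 < height
  | 5 | 6 => x.2 <= n
  | _ => false
  end.

Definition dom_ok (T : hash_table) R := forall x, x \in domf T -> allowed R x.

Record rep (T : hash_table) (R : seq (seq nat)) : Prop := Rep {
  rep0 : forall c : nat, ((0, c) \in domf T) = ((0, c) \in domf ptab);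
  rep_dom : dom_ok T R;
  rep1 : forall ps, ps \in R -> get T 1 (code ps) = bitmap ps;
  rep2 : forall j, j < size R -> get T 2 j = code (nth [::] R j);
  rep3 : forall j, j < size R -> get T 3 j = encode b (nth [::] R j);
  rep4 : forall j, j < size R -> get T 4 j = encode b (take K (tops (nth [::] R j))) }.

Lemma dom_ok_space R s : dom_ok (table s) R -> size R <= height -> top s = n.+1 ->
  space s <= S.
Proof.
move=> hd hR htop; rewrite /space htop /S /space_bound leq_add2l leq_mul2l /=.
pose row h m := [seq (h, c) | c <- iota 0 m] : seq (nat * nat).
pose l := domf ptab ++ [seq (1, c) | c <- [seq code ps | ps <- R]] ++
  row 2 height ++ row 3 height ++ row 4 height ++ row 5 n.+1 ++ row 6 n.+1.
have hl : {subset domf (table s) <= l}.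
  move=> [h c] /hd; rewrite /allowed /= !mem_cat => hx.
  have rowP h' m : c < m -> (h', c) \in row h' m.
    by move=> hc; apply: map_f; rewrite mem_iota.
  case: h hx => [|[|[|[|[|[|[|h]]]]]]] hx //; rewrite ?hx ?rowP ?orbT //.
  by rewrite [X in _ || (X || _)]map_f ?orbT.
have := uniq_leq_size (fset_uniq _) hl.
have -> : size l = #|` domf ptab|%fset +
    (size R + (height + (height + (height + (n.+1 + n.+1))))).
  by rewrite !size_cat !size_map !size_iota.
by move: #|` domf (table s)|%fset #|` domf ptab|%fset => x y; lia.
Qed.

Lemma dom_ok_mono T R R' : dom_ok T R -> {subset R <= R'} -> dom_ok T R'.
Proof.
move=> h hs [[|[|hh]] c] /h; rewrite /allowed //= => /mapP[ps hps ->].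
by apply: map_f; exact: hs.
Qed.

Lemma dom_ok_set T R h c v : dom_ok T R -> allowed R (h, c) ->
  dom_ok T.[(h, c) <- v]%fmap R.
Proof.
move=> hd ha x; rewrite dom_setf in_fset1U => /orP[/eqP -> //|]; exact: hd.
Qed.

Lemma code_inj ps qs : good ps -> good qs -> code ps = code qs -> ps = qs.
Proof.
move=> /and3P[vp _ hp] /and3P[vq _ hq] E; apply: perm_of_inj => //.
apply: encode_inj E.
- by apply: small_perm_of; lia.
- by apply: small_perm_of; lia.
- by rewrite mem_perm_of.
by rewrite mem_perm_of.
Qed.

Definition pattern_prog_frame r := [&& r < 50, r != 25 & r != 36].

Lemma wp_pattern_prog ps s : size ps < n -> space s <= S ->
  (forall c : nat, ((0, c) \in domf (table s)) = ((0, c) \in domf ptab)) ->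
  regs s 1 = K -> regs s 2 = b -> regs s 3 = 1 -> regs s 4 = 0 ->
  regs s 7 = size ps -> regs s 23 = code ps ->
  regs s 27 = (size ps).+1 -> regs s 29 = (size ps < K) ->
  wp w S pattern_prog (fun t s' => t <= 16 * K + 10 /\
     [/\ frame pattern_prog_frame s s',
      regs s' 25 = bits (size ps).+1 (fun q => perm_of (q :: ps) \notin Pi)
      & regs s' 36 = minn K (size ps)]) s.
Proof.
move=> hs hsp hT r1 r2 r3 r4 r7 r23 r27 r29.
have w1 := one_lt_word; have w0 : 0 < 2 ^ w by exact: ltnW.
have hsw : size ps < 2 ^ w by apply: le_n_lt_word; exact: ltnW.
have hKw : K < 2 ^ w by apply: le_n_lt_word; exact: geq_minr.
apply: wp_if; rewrite r29; have [hK|hK] := ltnP (size ps) K; last first.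
  rewrite /=; run.
    by rewrite mul1n; apply: pow_lt_word; rewrite -addn1 leq_S_2bn // ltnW.
  rewrite mul1n; run.
    by rewrite expn_gt0 /=; apply: pow_lt_word; rewrite -addn1 leq_S_2bn // ltnW.
  run; first by rewrite addn0.
  split; first by lia.
  split; last by lookup_to; rewrite addn0.
    by do !(apply: frame_set => //).
  lookup_to; rewrite -bits_ones; apply: eq_bits => q _; apply/esym.
  exact: (@long_perm_notin Pi n k K hPi (erefl _) q ps hK hs).
rewrite /=; run => //; run => //; run => //; run => //.
run; first by rewrite addn0.
set s1 := set_reg _ 36 _.
apply: wp_mono (@wp_pattern_loop ps s1 _ _ _ _ _ _ _ _ _ _ _) _; rewrite /s1 //; try lookup.
move=> t s' [ht [hf e25]]; split; first by lia.
have [f1 f2 f3 hfr] := hf.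
split=> //; last by lookup_to; rewrite addn0.
split=> // r /and3P[hr1 hr2 hr3]; rewrite hfr /pattern_frame ?hr1 //.
by rewrite !regs_ne //; lia.
Qed.

Lemma rep_push T R tau : rep T R -> (forall x : seq nat, x \in R -> good x) ->
  good tau -> tau \notin R -> size R < height ->
  let e := size R in
  rep T.[(1, code tau) <- bitmap tau].[(2, e) <- code tau].[(3, e) <- encode b tau]
       .[(4, e) <- encode b (take K (tops tau))]%fmap (rcons R tau).
Proof.
move=> hrep gR gtau nR hR e.
have hd : dom_ok T (rcons R tau).
  by apply: dom_ok_mono (rep_dom hrep) _ => x; rewrite mem_rcons inE => ->; rewrite orbT.
split=> [c||ps|j|j|j].
- by rewrite !dom_setf !in_fset1U !xpair_eqE (rep0 hrep).
- do 4!(apply: dom_ok_set => //).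
  by rewrite /allowed /=; apply: map_f; rewrite mem_rcons inE eqxx.
- rewrite !get_set /= mem_rcons inE; case: (eqVneq ps tau) => [-> _|ne /= hps].
    by rewrite eqxx.
  rewrite (rep1 hrep) // ifN //; apply: contraNneq ne => E.
  by apply/eqP/code_inj => //; exact: gR.
- rewrite size_rcons ltnS nth_rcons !get_set /= => hj; rewrite -/e.
  by case: (ltngtP j e) hj => // hj _; exact: (rep2 hrep).
- rewrite size_rcons ltnS nth_rcons !get_set /= => hj; rewrite -/e.
  by case: (ltngtP j e) hj => // hj _; exact: (rep3 hrep).
rewrite size_rcons ltnS nth_rcons !get_set /= => hj; rewrite -/e.
by case: (ltngtP j e) hj => // hj _; exact: (rep4 hrep).
Qed.

Lemma height_lt_word : height < 2 ^ w.
Proof.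
apply: leq_ltn_trans (_ : 2 ^ (b * K) < _); last first.
  by apply/pow_lt_word/leq_bM_2bn; exact: geq_minr.
rewrite /height -[in X in _ <= X](prednK (ltnW K1)) mulnS expnD leq_mul //.
by rewrite expnM leq_exp2r; [exact: ltnW | rewrite -ltnS prednK // ltnW].
Qed.

Definition child_frame r := (r < 20) && (r != 8).

Lemma wp_child p ps R s : let tau := p :: ps in let l := size tau in
  good tau -> rep (table s) R -> (forall x : seq nat, x \in R -> good x) ->
  tau \notin R -> size R < height -> top s = n.+1 ->
  (forall i, i < minn K l -> del_top i tau \in R) ->
  regs s 1 = K -> regs s 2 = b -> regs s 3 = 1 -> regs s 4 = 0 -> regs s 6 = n.-1 ->
  regs s 7 = l -> regs s 8 = size R -> regs s 16 = code ps -> regs s 17 = encode b ps ->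
  regs s 18 = encode b (take K (tops ps)) -> regs s 20 = p ->
  wp w S child (fun t s' => t <= 100 * K /\
    [/\ rep (table s') (rcons R tau), top s' = n.+1,
       regs s' 8 = (size R).+1 /\ (forall r, child_frame r -> regs s' r = regs s r),
       forall c, get (table s') 5 c = get (table s) 5 c /\ get (table s') 6 c = get (table s) 6 c
     & forall m, memory s' m =
         if m == l.+1 then (memory s m + num_ext tau) %% 2 ^ w else memory s m]) s.
Proof.
move=> tau l gtau hrep gR nR hR htop hdlt r1 r2 r3 r4 r6 r7 r8 r16 r17 r18 r20.
have /and3P[vt avt hl] := gtau; rewrite -/l in hl.
have hpl : p < l by move: (vt) => /= /andP[]; rewrite /l /=.
have hln : l <= n by exact: ltnW.
have hpn : p <= n by apply: leq_trans (ltnW hpl) hln.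
have hl1 : l = (size ps).+1 by [].
have hsps : size ps <= n by apply: leq_trans hln; rewrite hl1.
have hpsb : size ps < 2 ^ b by apply: leq_ltn_trans hsps nb.
have hlb : l < 2 ^ b by apply: ltn_trans hl nb.
have hpb : p < 2 ^ b by apply: leq_ltn_trans hpn nb.
have w1 := one_lt_word; have w0 : 0 < 2 ^ w by exact: ltnW.
have hd0 : dom_ok (table s) (rcons R tau).
  by apply: dom_ok_mono (rep_dom hrep) _ => x; rewrite mem_rcons inE => ->; rewrite orbT.
have hRs : size (rcons R tau) <= height by rewrite size_rcons.
have hsp : space s <= S by apply: dom_ok_space hd0 hRs htop.
have sm : small b (perm_of ps) by apply: small_perm_of.
have smt : small b (perm_of tau) by apply: small_perm_of; rewrite -/l.
have hE := encode_ins l sm (_ : p <= size (perm_of ps)).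
have {}hE : code tau = code ps %% 2 ^ (b * p) + l * 2 ^ (b * p)
    + code ps %/ 2 ^ (b * p) * 2 ^ (b * p + b).
  by rewrite -hE // size_perm_of -ltnS.
have hlt : code tau < 2 ^ w by apply: encode_lt_word; rewrite ?size_perm_of.
have [hB hC hAB] := sum3_lt hE hlt.
have vps : valid ps by case/andP: vt.
have small_ps qs : valid qs -> size qs <= n -> small b qs.
  elim: qs => //= q qs IH /andP[hq hv] hn; rewrite IH ?andbT //; last exact: ltnW.
  by apply: leq_ltn_trans (leq_trans hq (ltnW hn)) nb.
have smps : small b ps by apply: small_ps.
have hPE : encode b tau = p + 2 ^ b * encode b ps by rewrite encode_cons.
have hPlt : encode b tau < 2 ^ w by apply: encode_lt_word; [apply: small_ps|].
have hIlt : encode b (take K (tops ps)) < 2 ^ w.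
  apply: encode_lt_word; first by apply: small_take; apply: small_tops => //; exact: ltnW.
  by rewrite size_take_min size_tops (leq_trans (geq_minr _ _)).
rewrite /child.
run; first by apply/lin_lt_word/leq_bM_2bn.
run; first by rewrite mul1n pow_lt_word // leq_bM_2bn.
rewrite mul1n; run.
run => //.
run => //.
run.
run; first by apply/lin_lt_word/leq_bMD_2bn.
run => //.
run; first by rewrite -hE.
rewrite -hE.
run; first by apply: leq_ltn_trans hPlt; rewrite hPE mulnC leq_addl.
run; first by rewrite mulnC addnC -hPE.
rewrite [encode b ps * _]mulnC [_ + p]addnC -hPE.
run; first by apply: le_n_lt_word; rewrite addn1.
rewrite addn1; run.
set s1 := set_reg _ 29 _.
apply: wp_seq.
apply: wp_mono (@wp_pattern_prog tau s1 _ _ _ _ _ _ _ _ _ _ _) _ => //.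
all: try by (rewrite /s1; lookup).
  by move=> c; exact: (rep0 hrep).
move=> t1 s2 [ht1 [hf2 e25 e36]]; have hsp2 : space s2 <= S.
  by rewrite (frame_space hf2) /s1; space_tac.
have [f1 f2 f3 hfr2] := hf2.
have g23 : regs s2 23 = code tau by rewrite hfr2 // /s1; lookup.
have g24 : regs s2 24 = encode b tau by rewrite hfr2 // /s1; lookup.
have g27 : regs s2 27 = l.+1 by rewrite hfr2 // /s1; lookup.
have g20 : regs s2 20 = p by rewrite hfr2 // /s1; lookup.
have g18 : regs s2 18 = encode b (take K (tops ps)) by rewrite hfr2 // /s1; lookup.
have glow r : r < 21 -> regs s2 r = regs s r.
  move=> hr; rewrite hfr2 /s1; last by move: hr; clear; rewrite /pattern_prog_frame; lia.
  by rewrite !(regs_low hr).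
run; first by rewrite addn0.
rewrite addn0; run => //.
run; first by rewrite addn0; apply: le_n_lt_word.
rewrite addn0; run => //.
run; first by rewrite addn0.
rewrite addn0; run => //.
run => //.
set s3 := set_reg _ 35 _.
apply: wp_seq; apply: wp_mono (@wp_deletion_loop p ps _ s3 _ _ _ _ _ _ _ _ _ _ _ _ _ _ _ _) _.
all: try by (rewrite /s3; lookup).
- exact: gtau.
- exact: ltnW K1.
- by rewrite /s3; space_tac.
- move=> i hi; have hdl := hdlt i hi.
  have -> : get (table s3) 1 (code (del_top i tau)) = get (table s) 1 (code (del_top i tau)).
    by rewrite /s3 [table _]/= f2.
  rewrite (rep1 hrep) // /bitmap size_del_top; last by apply: leq_trans hi (geq_minr _ _).
  by rewrite ifT // -/l -ltnS prednK // prednK.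
move=> t2 s4 [ht2 [hf4 e26 e25']].
have [m1 m2 m3 hfr4] := hf4.
have T4 : table s4 = table s by rewrite m2 /s3 [LHS]/= f2.
have M4 : memory s4 = memory s by rewrite m1 /s3 [LHS]/= f1.
have htop4 : top s4 = n.+1 by rewrite m3 /s3 [LHS]/= f3.
have hlow r : r < 20 -> regs s4 r = regs s r.
  move=> hr; rewrite hfr4 /s3; last by move: hr; clear; rewrite /deletion_frame; lia.
  by rewrite !(regs_low hr) // glow // ltnW.
have h23 : regs s4 23 = code tau by rewrite hfr4 // /s3; lookup.
have h24 : regs s4 24 = encode b tau by rewrite hfr4 // /s3; lookup.
have h27 : regs s4 27 = l.+1 by rewrite hfr4 // /s3; lookup.
have h3 : regs s4 3 = 1 by rewrite hlow.
have h6 : regs s4 6 = n.-1 by rewrite hlow.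
have h7 : regs s4 7 = l by rewrite hlow.
have h8 : regs s4 8 = size R by rewrite hlow.
have {e25'} e25' : regs s4 25 = bits l.+1 (fun q => avoiding (q :: tau)).
  rewrite e25'; apply: eq_bits => q hq.
  by rewrite (avoiding_cons hPi (erefl K) gtau).
have hlw : l.+1 <= w.
  by apply: leq_trans hw; move: (leq_S_2bn hln); clear; rewrite addn1; lia.
have hbw : bits l.+1 (fun q => avoiding (q :: tau)) < 2 ^ w.
  by apply: leq_trans (bits_lt _ _) _; rewrite leq_exp2l.
have hspA s' : top s' = n.+1 -> dom_ok (table s') (rcons R tau) -> space s' <= S.
  by move=> h1 h2; apply: dom_ok_space h2 hRs h1.
have hsp4 : space s4 <= S by apply: hspA => //; rewrite T4.
have hd4 : dom_ok (table s4) (rcons R tau) by rewrite T4.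
have al1 : allowed (rcons R tau) (1, code tau).
  by rewrite /allowed /=; apply: map_f; rewrite mem_rcons inE eqxx.
have al2 : allowed (rcons R tau) (2, size R) by [].
have al3 : allowed (rcons R tau) (3, size R) by [].
have al4 : allowed (rcons R tau) (4, size R) by [].
run; first by apply: popcount_bits.
run; first by rewrite M4; reflexivity.
  by rewrite [top _]/= htop4.
apply: wp_seq; eapply wp_bin; [lookup|lookup|reflexivity|space_tac|cbv beta].
run; first by rewrite [top _]/= htop4.
run.
run.
  by case: (l < _); rewrite ?muln1 ?muln0.
have -> : bits l.+1 (fun q => avoiding (q :: tau)) * (l < n.-1) = bitmap tau.
  by rewrite /bitmap -/l; case: ifP => _; rewrite ?muln1 ?muln0.
run; first by apply: hspA; [exact: htop4 | exact: (dom_ok_set hd4)].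
have hd5 := @dom_ok_set _ _ _ _ (bitmap tau) hd4 al1.
run.
  by apply: hspA; [exact: htop4 | exact: hd5].
  by apply: hspA; [exact: htop4 | exact: (dom_ok_set hd5)].
have hd6 := @dom_ok_set _ _ _ _ (code tau) hd5 al2.
run.
  by apply: hspA; [exact: htop4 | exact: hd6].
  by apply: hspA; [exact: htop4 | exact: (dom_ok_set hd6)].
have hd7 := @dom_ok_set _ _ _ _ (encode b tau) hd6 al3.
run.
  by apply: hspA; [exact: htop4 | exact: hd7].
  by apply: hspA; [exact: htop4 | exact: (dom_ok_set hd7)].
have hd8 := @dom_ok_set _ _ _ _ (encode b (take K (tops tau))) hd7 al4.
run.
  by apply: leq_ltn_trans (_ : height < _); [rewrite addn1|exact: height_lt_word].
  by apply: hspA; [exact: htop4 | exact: hd8].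
split; first by move: K1 ht1 ht2; clear; lia.
split.
- by rewrite /= T4; exact: rep_push.
- exact: htop4.
- split; first by lookup_to; rewrite addn1.
  move=> r /andP[hr hr8]; rewrite regs_ne ?(negPf hr8) // !regs_table !(regs_low hr) //.
  by rewrite hlow.
- by move=> c; rewrite /= T4 !get_set.
move=> m; rewrite /= M4; case: eqP => // ->; reflexivity.
Qed.

Record base (s : state) : Prop := Base {
  base1 : regs s 1 = K; base2 : regs s 2 = b; base3 : regs s 3 = 1;
  base4 : regs s 4 = 0; base5 : regs s 5 = b * K.-2; base6 : regs s 6 = n.-1;
  base_top : top s = n.+1; base_mem : forall m, memory s m < 2 ^ w }.

(* The counters are only known modulo 2 ^ w during the search. *)
Definition mem_add (s s' : state) (increments : nat -> nat) :=
  forall m, memory s' m = (memory s m + increments m) %% 2 ^ w.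

Lemma mem_add_trans s1 s2 s3 i1 i2 i3 : mem_add s1 s2 i1 -> mem_add s2 s3 i2 ->
  (forall m, i1 m + i2 m = i3 m) -> mem_add s1 s3 i3.
Proof. by move=> h1 h2 h3 m; rewrite h2 h1 modnDml -addnA h3. Qed.

Lemma mem_add0 s s' increments : base s -> memory s' = memory s -> (forall m, increments m = 0) ->
  mem_add s s' increments.
Proof. by move=> hb E h m; rewrite E h addn0 modn_small // base_mem. Qed.

Lemma base_frame s s' increments : base s -> (forall r, r < 7 -> regs s' r = regs s r) ->
  top s' = top s -> mem_add s s' increments -> base s'.
Proof.
move=> [h1 h2 h3 h4 h5 h6 h7 h8] hr ht hm; split; rewrite ?hr ?ht //.
by move=> m; rewrite hm ltn_mod expn_gt0.
Qed.

Lemma base_same s s' : base s -> (forall r, r < 7 -> regs s' r = regs s r) ->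
  top s' = top s -> memory s' = memory s -> base s'.
Proof. by move=> hb hr ht hm; apply: (base_frame hb hr ht (mem_add0 hb hm (fun => erefl 0))). Qed.

Definition same_levels (T T' : hash_table) :=
  forall c, get T' 5 c = get T 5 c /\ get T' 6 c = get T 6 c.

Definition child_positions ps :=
  if size ps < n.-1 then [seq q <- iota 0 (size ps).+1 | avoiding (q :: ps)] else [::].

Lemma children_positions ps : children ps = [seq q :: ps | q <- child_positions ps].
Proof. by rewrite /children /child_positions; case: ifP. Qed.

Lemma bitmap_positions ps : bitmap ps = bits (size ps).+1 [in child_positions ps].
Proof.
by rewrite /bitmap /child_positions; case: ifP => _; rewrite -?bits_filter // bits_nil.
Qed.

Lemma child_positions_sorted ps : sorted ltn (child_positions ps).
Proof.
rewrite /child_positions; case: ifP => // _.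
apply: sorted_filter; [exact: ltn_trans | exact: iota_ltn_sorted].
Qed.

Lemma child_positions_le ps q : q \in child_positions ps -> q < (size ps).+1.
Proof. by rewrite /child_positions; case: ifP => // _; rewrite mem_filter mem_iota => /andP[]. Qed.

Lemma good_children ps x : good ps -> x \in children ps -> good x /\ size x = (size ps).+1.
Proof.
case: x => [|q x] gps; first by rewrite nil_children.
rewrite mem_children => /and4P[/eqP -> h1 h2 h3]; split=> //.
by rewrite good_cons gps h1 h2 h3.
Qed.

Definition bits_frame r := (r < 19) && (r != 8).

Lemma wp_bits ps R s :
  base s -> rep (table s) R -> (forall x : seq nat, x \in R -> good x) -> good ps ->
  regs s 7 = (size ps).+1 -> regs s 8 = size R -> regs s 16 = code ps ->
  regs s 17 = encode b ps -> regs s 18 = encode b (take K (tops ps)) ->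
  regs s 19 = bitmap ps -> uniq (R ++ children ps) -> size R + size (children ps) <= height ->
  (forall (tau : seq nat) i, tau \in children ps -> i < minn K (size ps).+1 ->
     del_top i tau \in R) ->
  wp w S (While 19 bits_body) (fun t s' => t <= size (children ps) * (100 * K + 4) + 1 /\
    [/\ rep (table s') (R ++ children ps), base s',
       regs s' 8 = size R + size (children ps) /\ (forall r, bits_frame r -> regs s' r = regs s r),
       same_levels (table s) (table s')
     & mem_add s s' (fun m => (m == (size ps).+2) * \sum_(x <- children ps) num_ext x)]) s.
Proof.
move=> hb hrep gR gps r7 r8 r16 r17 r18 r19 uR hR hdlt.
set l := (size ps).+1 in r7 hdlt *; set qs := child_positions ps.
have Ech : children ps = [seq q :: ps | q <- qs] by exact: children_positions.
have hln : l <= n by case/and3P: gps.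
pose Inv j s' := [/\ rep (table s') (R ++ take j (children ps)), base s',
  [/\ regs s' 8 = size R + j, regs s' 19 = bits l [in drop j qs]
   & forall r, bits_frame r -> regs s' r = regs s r],
  same_levels (table s) (table s')
  & mem_add s s' (fun m => (m == l.+1) * \sum_(x <- take j (children ps)) num_ext x)].
have szq : size (children ps) = size qs by rewrite Ech size_map.
have hspR s' j : rep (table s') (R ++ take j (children ps)) -> top s' = n.+1 -> space s' <= S.
  move=> h1 h2; apply: (dom_ok_space (rep_dom h1) _ h2).
  by apply: leq_trans hR; rewrite size_cat leq_add2l size_take_min geq_minr.
apply: wp_mono
  (@wp_for w S 19 bits_body (fun _ => 100 * K + 3) (size (children ps)) Inv s _ _ _) _;
  last 3 first.
- move=> s1 [h1 h2 [_ h3 _] _ _]; rewrite h3 szq drop_size bits_nil; split=> //.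
  exact: hspR h1 (base_top h2).
- split=> //; first by rewrite take0 cats0.
  + by split=> //; rewrite ?addn0 // drop0 r19 bitmap_positions.
  + by apply: mem_add0 => // m; rewrite take0 big_nil muln0.
- move=> t s' [ht]; rewrite /Inv take_size => -[h1 h2 [h3 _ h4] h5 h6].
  by split=> //; rewrite sum_nat_const card_ord in ht; lia.
move=> j s1 hj [i1 i2 [i8 i19 ifr] i56 imem].
have hjq : j < size qs by rewrite -szq.
set q := nth 0 qs j; have Eq : drop j qs = q :: drop j.+1 qs by exact: drop_nth.
have hql : q < l by apply: child_positions_le; exact: mem_nth.
have Etau : nth [::] (children ps) j = q :: ps by rewrite Ech (nth_map 0).
have tauin : q :: ps \in children ps by rewrite -Etau mem_nth.
have srt : path ltn q (drop j.+1 qs).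
  by have := drop_sorted j (child_positions_sorted ps); rewrite -/qs Eq.
have hall : all (ltn q) (drop j.+1 qs) by apply: order_path_min srt; exact: ltn_trans.
have qnin : q \notin drop j.+1 qs by apply/negP => /(allP hall) /=; rewrite ltnn.
rewrite Eq in i19; have Epop := bits_pop hql qnin.
split; first by rewrite i19 Epop -lt0n addn_gt0 expn_gt0 orbT.
have hlw : l <= w by apply: leq_trans hw; move: (leq_S_2bn hln); clear; lia.
have hsp1 : space s1 <= S by apply: hspR i1 (base_top i2).
have [b1 b2 b3 b4 b5 b6 btop bmem] := i2.
have w1 := one_lt_word.
have hbw : bits l [in q :: drop j.+1 qs] < 2 ^ w.
  by apply: leq_trans (bits_lt _ _) _; rewrite leq_exp2l.
rewrite /bits_body; run; first by apply: ctz_bits.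
run; first by rewrite mul1n ltn_exp2l // (leq_trans hql).
rewrite mul1n; run; first by rewrite Epop leq_addl -Epop.
rewrite Epop addnK; set s2 := set_reg _ 19 _.
have [gtau stau] := good_children gps tauin.
have c7 : regs s1 7 = l by rewrite ifr.
have c16 : regs s1 16 = code ps by rewrite ifr.
have c17 : regs s1 17 = encode b ps by rewrite ifr.
have c18 : regs s1 18 = encode b (take K (tops ps)) by rewrite ifr.
have Ecat : rcons (R ++ take j (children ps)) (q :: ps) = R ++ take j.+1 (children ps).
  by rewrite (take_nth [::]) // Etau rcons_cat.
have hsz : size (R ++ take j (children ps)) = size R + j by rewrite size_cat size_takel // ltnW.
have uR' : uniq (R ++ take j.+1 (children ps)).
  by apply: subseq_uniq uR; rewrite cat_subseq // take_subseq.
apply: wp_mono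
  (@wp_child q ps (R ++ take j (children ps)) s2 _ _ _ _ _ _ _ _ _ _ _ _ _ _ _ _ _ _) _.
all: try by (rewrite /s2; lookup).
- exact: gtau.
- exact: i1.
- move=> x; rewrite mem_cat => /orP[/gR //|/mem_take hx]; by case: (good_children gps hx).
- by move: uR'; rewrite -Ecat rcons_uniq => /andP[].
- by rewrite hsz; apply: leq_trans hR; rewrite ltn_add2l.
- by [].
- by move=> i hi; rewrite mem_cat (hdlt _ _ tauin).
- by rewrite hsz /s2; lookup.
move=> t s3 [ht [p1 p2 [p3 p4] p5 p6]].
split; first by lia.
split.
- by rewrite -Ecat.
- apply: (@base_frame s1 s3 (fun m => (m == l.+1) * num_ext (q :: ps))) => //.
  + by move=> r hr; rewrite p4 /s2 /child_frame ?(regs_low hr) //; lia.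
  + by rewrite p2.
  + move=> m; rewrite p6; case: eqP => [->|_] /=; first by rewrite mul1n.
    by rewrite addn0 modn_small.
- split; first by rewrite p3 hsz addnS.
    rewrite p4 // /s2; lookup.
  move=> r hr; rewrite p4 /s2; last by move: hr; rewrite /bits_frame /child_frame; lia.
  by rewrite -ifr //; have /andP[hr' _] := hr; rewrite !(regs_low hr').
- by move=> c; have [-> ->] := p5 c; exact: i56.
apply: (mem_add_trans imem) (_ : mem_add s1 s3 (fun m => (m == l.+1) * num_ext (q :: ps))) _.
  move=> m; rewrite p6; case: eqP => [->|_] /=; first by rewrite mul1n.
  by rewrite addn0 modn_small.
by move=> m; rewrite (take_nth [::]) // Etau big_rcons /= -mulnDr addnC.
Qed.

Lemma small_valid ps : valid ps -> size ps <= n -> small b ps.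
Proof.
elim: ps => //= q ps IH /andP[hq hv] hn; rewrite IH ?andbT //; last exact: ltnW.
by apply: leq_ltn_trans (leq_trans hq (ltnW hn)) nb.
Qed.

Lemma encode_key ps : good ps -> encode b ps %/ 2 ^ (b * K.-2) = encode b (key ps).
Proof.
by case/and3P=> hv _ hs; rewrite /key encode_drop // small_valid // ltnW.
Qed.

Lemma key_inj d x y : good x -> good y -> size x = d -> size y = d ->
  encode b (key x) = encode b (key y) -> key x = key y.
Proof.
case/and3P=> vx _ hx /and3P[vy _ hy] sx sy; apply: encode_inj_size.
- by apply: small_drop; apply: small_valid; rewrite // ltnW.
- by apply: small_drop; apply: small_valid; rewrite // ltnW.
by rewrite !size_drop sx sy.
Qed.

Lemma good_expand L : (forall x : seq nat, x \in L -> good x) ->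
  forall y : seq nat, y \in expand L -> good y.
Proof.
move=> gL [|q y]; first by rewrite nil_expand.
by rewrite mem_expand good_cons => /and4P[/gL -> -> -> ->].
Qed.

Definition group_frame r := [|| r < 8, r == 10, r == 11 | r == 14].

Lemma wp_group d R1 G Lr s : let R := R1 ++ G ++ Lr in
  base s -> rep (table s) R -> (forall x : seq nat, x \in R -> good x) ->
  (forall x : seq nat, x \in G ++ Lr -> size x = d) ->
  {in G &, forall x y, key x = key y} ->
  (forall x L, Lr = x :: L -> key x != key (head [::] G)) ->
  uniq (R ++ expand G) -> size R + size (expand G) <= height ->
  (forall (tau : seq nat) i, tau \in expand G -> i < minn K d.+1 -> del_top i tau \in R) ->
  regs s 7 = d.+1 -> regs s 8 = size R -> regs s 9 = size R1 -> regs s 10 = size R ->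
  regs s 11 = encode b (key (head [::] G)) -> regs s 12 = (0 < size G) ->
  wp w S (While 12 rec_body) (fun t s' =>
    t <= size (expand G) * (100 * K + 4) + size G * 12 + 1 /\
    [/\ rep (table s') (R ++ expand G), base s',
       [/\ regs s' 8 = size R + size (expand G), regs s' 9 = size R1 + size G
         & forall r, group_frame r -> regs s' r = regs s r],
       same_levels (table s) (table s')
     & mem_add s s' (fun m => (m == d.+2) * \sum_(x <- expand G) num_ext x)]) s.
Proof.
move=> R hb hrep gR szd keyG keyL uR hR hdlt r7 r8 r9 r10 r11 r12.
pose E j := expand (take j G).
pose Inv j s' := [/\ rep (table s') (R ++ E j), base s',
  [/\ regs s' 8 = size R + size (E j), regs s' 9 = size R1 + j,
      regs s' 12 = (j < size G) & forall r, group_frame r -> regs s' r = regs s r],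
  same_levels (table s) (table s')
  & mem_add s s' (fun m => (m == d.+2) * \sum_(x <- E j) num_ext x)].
have EG : E (size G) = expand G by rewrite /E take_size.
have subE j : exists2 Y, expand G = E j ++ Y & forall x, x \in Y -> x \in expand G.
  exists (expand (drop j G)); first by rewrite -expand_cat cat_take_drop.
  by move=> x hx; rewrite -[G](cat_take_drop j) expand_cat mem_cat hx orbT.
have szE j : size (E j) <= size (expand G).
  by have [Y -> _] := subE j; rewrite size_cat leq_addr.
have hspR s' j : rep (table s') (R ++ E j) -> top s' = n.+1 -> space s' <= S.
  move=> h1 h2; apply: (dom_ok_space (rep_dom h1) _ h2).
  by apply: leq_trans hR; rewrite size_cat leq_add2l.
have Rsz : size R = size R1 + (size G + size Lr) by rewrite /R !size_cat.
pose cost j := size (children (nth [::] G j)) * (100 * K + 4) + 11.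
have costE : \sum_(j < size G) (cost j).+1 = size (expand G) * (100 * K + 4) + size G * 12.
  rewrite /cost; elim: (G) => [|x G' IH]; first by rewrite big_ord0.
  by rewrite big_ord_recl /= {}IH /expand /= size_cat mulnDl; lia.
apply: wp_mono (@wp_for w S 12 rec_body cost (size G) Inv s _ _ _) _; last 3 first.
- by move=> s1 [h1 h2 [_ _ -> _] _ _]; rewrite ltnn; split=> //; apply: hspR h1 (base_top h2).
- split=> //; first by rewrite /E take0 cats0.
  + by split=> //; rewrite /E ?take0 addn0.
  + by apply: mem_add0 => // m; rewrite /E take0 big_nil muln0.
- move=> t s' [ht]; rewrite /Inv EG => -[h1 h2 [h3 h3' _ h4] h5 h6].
  by split=> //; rewrite costE in ht; rewrite addn1.
move=> j s1 hj [i1 i2 [i8 i9 i12 ifr] i56 imem]; rewrite i12 hj; split=> //.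
set ps := nth [::] G j.
have psG : ps \in G by exact: mem_nth.
have psR : ps \in R by rewrite /R !mem_cat psG orbT.
have gps : good ps by exact: gR.
have sps : size ps = d by apply: szd; rewrite mem_cat psG.
have hsp1 : space s1 <= S by apply: hspR i1 (base_top i2).
have [b1 b2 b3 b4 b5 b6 btop bmem] := i2.
have idx i : i < size G + size Lr -> nth [::] (R ++ E j) (size R1 + i) = nth [::] (G ++ Lr) i.
  move=> hi; rewrite nth_cat Rsz ltn_add2l hi /R nth_cat ltnNge leq_addr /=.
  by rewrite addKn.
have psE : nth [::] (R ++ E j) (size R1 + j) = ps.
  by rewrite idx ?(leq_trans hj) ?leq_addr // nth_cat hj.
have jlt : size R1 + j < size (R ++ E j).
  by rewrite size_cat Rsz -addnA ltn_add2l (leq_trans hj) // -addnA leq_addr.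
have Ej1 : E j.+1 = E j ++ children ps.
  by rewrite /E (take_nth [::]) // -cats1 expand_cat /expand /= cats0.
have chsub x : x \in children ps -> x \in expand G.
  move=> hx; have [Y -> _] := subE j.+1; by rewrite Ej1 !mem_cat hx orbT.
rewrite /rec_body.
have g2 : get (table s1) 2 (size R1 + j) = code ps by rewrite (rep2 i1) ?psE.
have g3 : get (table s1) 3 (size R1 + j) = encode b ps by rewrite (rep3 i1) ?psE.
have g4 : get (table s1) 4 (size R1 + j) = encode b (take K (tops ps)).
  by rewrite (rep4 i1) ?psE.
have g1 : get (table s1) 1 (code ps) = bitmap ps by rewrite (rep1 i1) // mem_cat psR.
run; first exact: g2.
run; first exact: g3.
run; first exact: g4.
run; first exact: g1.
set s2 := set_reg _ 19 _.
apply: wp_seq.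
apply: wp_mono (@wp_bits ps (R ++ E j) s2 _ _ _ _ _ _ _ _ _ _ _ _ _) _.
all: try by (rewrite /s2; lookup).
- by apply: (base_same i2) => // r hr; rewrite /s2 !(regs_low hr).
- exact: i1.
- move=> x; rewrite mem_cat => /orP[/gR //|].
  move=> hx; apply: (good_expand (L := G)); last by have [Y -> _] := subE j; rewrite mem_cat hx.
  by move=> y hy; apply: gR; rewrite /R !mem_cat hy orbT.
- exact: gps.
- by rewrite /s2; lookup_to; rewrite sps.
- by rewrite size_cat /s2; lookup.
- rewrite -catA -Ej1; apply: subseq_uniq uR; rewrite cat_subseq //.
  by have [Y -> _] := subE j.+1; rewrite prefix_subseq.
- by rewrite size_cat -addnA -size_cat -Ej1 (leq_trans _ hR) // leq_add2l.
- by move=> tau i /chsub h1; rewrite sps => h2; rewrite mem_cat (hdlt tau).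
move=> t s3 [ht [p1 p2 [p3 p4] p5 p6]].
have hh := height_lt_word.
have hRh : size R1 + size G <= height.
  by apply: leq_trans hR; rewrite Rsz addnA -addnA leq_addr.
have hsp3 : space s3 <= S.
  by apply: hspR (_ : rep (table s3) (R ++ E j.+1)) (base_top p2); rewrite Ej1 catA.
have [d1 d2 d3 d4 d5 d6 dtop dmem] := p2.
have c9 : regs s3 9 = size R1 + j by rewrite p4 // /s2; lookup.
have c10 : regs s3 10 = size R by rewrite p4 // /s2; lookup.
have c11 : regs s3 11 = encode b (key (head [::] G)) by rewrite p4 // /s2; lookup.
run; first by apply: leq_ltn_trans hh; apply: leq_trans hRh; rewrite -addnA leq_add2l addn1.
rewrite addn1 -addnS; run.
run; first by reflexivity.
run.
run.
have w1 := one_lt_word;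
run; first by rewrite mulnb; apply: leq_ltn_trans (leq_b1 _) w1.
split; first by move: ht; rewrite /cost -/ps; lia.
split.
- by rewrite /= Ej1 catA.
- by apply: (base_same p2) => // r hr; rewrite !(regs_low hr).
- split.
  + by rewrite Ej1 size_cat addnA -size_cat; lookup.
  + by lookup.
  + have szle i : i < size R -> i < size ((R ++ E j) ++ children ps).
      by move=> h; rewrite -catA size_cat ltn_addr.
    have szle1 i : i < size R -> i < size (R ++ E j) by move=> h; rewrite size_cat ltn_addr.
    lookup_to; rewrite [table _]/=.
    have [hj1|hj1] := ltnP j.+1 (size G).
      have hlt : size R1 + j.+1 < size R by rewrite Rsz ltn_add2l (leq_trans hj1) // leq_addr.
      rewrite hlt (rep3 p1); last exact: szle.
      have Enth : nth [::] ((R ++ E j) ++ children ps) (size R1 + j.+1) = nth [::] G j.+1.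
        rewrite nth_cat szle1 // idx ?nth_cat ?hj1 //.
        by rewrite (leq_trans hj1) ?leq_addr.
      have hin : nth [::] G j.+1 \in G by exact: mem_nth.
      rewrite Enth encode_key; last by apply: gR; rewrite /R !mem_cat hin orbT.
      rewrite (keyG _ (head [::] G)) ?eqxx //.
      by rewrite -nth0 mem_nth //; apply: leq_trans hj.
    have Ej : j.+1 = size G by apply/eqP; rewrite eqn_leq hj hj1.
    rewrite Ej Rsz ltn_add2l -[X in X < _]addn0 ltn_add2l.
    case ELr : Lr => [|x L]; first by rewrite mul0n.
    have xin : x \in Lr by rewrite ELr inE eqxx.
    have hlt : size R1 + size G < size R.
      by rewrite Rsz ltn_add2l -[X in X < _]addn0 ltn_add2l ELr.
    rewrite (rep3 p1); last exact: szle.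
    have Enth : nth [::] ((R ++ E j) ++ children ps) (size R1 + size G) = x.
      rewrite nth_cat szle1 // idx ?nth_cat ?ltnn ?subnn ?ELr //=.
      by rewrite -[X in X < _]addn0 ltn_add2l.
    have gx : good x by apply: gR; rewrite /R !mem_cat xin !orbT.
    rewrite Enth encode_key // [X in _ * X](_ : _ = 0) ?muln0 //.
    apply/eqP; rewrite eqb0; apply/negP => /eqP Ek.
    have hin : head [::] G \in G by rewrite -nth0 mem_nth //; apply: leq_trans hj.
    have := keyL x L ELr; rewrite (@key_inj d x (head [::] G) gx _ _ _ Ek) ?eqxx //.
    * by apply: gR; rewrite /R !mem_cat hin orbT.
    * by apply: szd; rewrite mem_cat xin orbT.
    * by apply: szd; rewrite mem_cat hin.
  + move=> r hr; rewrite -ifr //.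
    have hr' : bits_frame r by move: hr; clear; rewrite /group_frame /bits_frame; lia.
    have hr9 : (r == 9) = false by move: hr; clear; rewrite /group_frame; lia.
    have hr12 : (r == 12) = false by move: hr; clear; rewrite /group_frame; lia.
    have hr13 : (r == 13) = false by move: hr; clear; rewrite /group_frame; lia.
    have hr19 : r < 16 by move: hr; clear; rewrite /group_frame; lia.
    by rewrite !regs_ne // p4 // /s2 !(regs_low hr19).
- by move=> c; have [E5 E6] := p5 c; rewrite /= E5 E6; exact: i56.
apply: (mem_add_trans imem p6) => m.
by rewrite sps Ej1 big_cat /= mulnDr.
Qed.

Lemma le_n1_lt_word x : x <= n.+1 -> x < 2 ^ w.
Proof. by move=> h; apply: lin_lt_word; apply: leq_trans h _; rewrite -addn1 leq_S_2bn. Qed.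

Lemma rep_pop T R ps : rep T (rcons R ps) -> uniq (rcons R ps) ->
  (forall x : seq nat, x \in rcons R ps -> good x) ->
  rep T.[~ (1, code ps)]%fmap R.
Proof.
move=> h uR gR.
have nth_r j : j < size R -> j < size (rcons R ps) /\ nth [::] (rcons R ps) j = nth [::] R j.
  by move=> hj; rewrite size_rcons nth_rcons hj; split=> //; rewrite ltnW.
have neq x : x \in R -> code x != code ps.
  move=> hx; move: uR; rewrite rcons_uniq => /andP[hp _]; apply: contraNneq hp => E.
  have <- : x = ps by apply: code_inj => //; apply: gR; rewrite mem_rcons inE ?eqxx ?hx ?orbT.
  by [].
split=> [c|x|x hx|j hj|j hj|j hj].
- by rewrite -(rep0 h) mem_remf1.
- rewrite mem_remf1 => /andP[hx /(rep_dom h)]; case: x hx => [[|[|hh]] c] //.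
  rewrite /allowed /= map_rcons mem_rcons inE xpair_eqE /= => hc.
  by rewrite (negPf hc).
- rewrite get_rem ?(rep1 h) //; first by rewrite mem_rcons inE hx orbT.
  by rewrite /= neq.
- by have [h1 h2] := nth_r j hj; rewrite get_rem // (rep2 h) // h2.
- by have [h1 h2] := nth_r j hj; rewrite get_rem // (rep3 h) // h2.
by have [h1 h2] := nth_r j hj; rewrite get_rem // (rep4 h) // h2.
Qed.

Lemma rep_set_level T R h c v : rep T R -> (h == 5) || (h == 6) -> c <= n ->
  rep T.[(h, c) <- v]%fmap R.
Proof.
move=> hr hh hc; have hne i : i < 5 -> (i == h) = false.
  by case/orP: hh => /eqP -> {hr hc}; case: i => [|[|[|[|[|]]]]].
split=> [c'||x hx|j hj|j hj|j hj].
- by rewrite dom_setf in_fset1U xpair_eqE hne // (rep0 hr).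
- by apply: dom_ok_set (rep_dom hr) _; case/orP: hh => /eqP ->.
- by rewrite get_set hne // (rep1 hr).
- by rewrite get_set hne // (rep2 hr).
- by rewrite get_set hne // (rep3 hr).
by rewrite get_set hne // (rep4 hr).
Qed.

Lemma wp_pop d R0 L s : let R := R0 ++ L in
  base s -> rep (table s) R -> (forall x : seq nat, x \in R -> good x) -> uniq R ->
  size R <= height -> d < n.+1 ->
  regs s 8 = size R -> regs s 14 = d -> get (table s) 5 d = size R0 ->
  wp w S pop_prog (fun t s' => t <= size L * 5 + 4 /\
    [/\ rep (table s') R0, base s', regs s' 8 = size R0 /\ regs s' 7 = d,
       same_levels (table s) (table s') & memory s' = memory s]) s.
Proof.
move=> R hb hrep gR uR hR hdn r8 r14 g5.
have hsp : space s <= S by apply: dom_ok_space (rep_dom hrep) hR (base_top hb).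
have [b1 b2 b3 b4 b5 b6 btop bmem] := hb.
have w1 := one_lt_word; have hh := height_lt_word.
rewrite /pop_prog; run; first exact: g5.
run.
set s1 := set_reg _ 12 _.
pose N := size L.
pose Inv j s' := [/\ rep (table s') (take (size R - j) R), base s',
   [/\ regs s' 8 = size R - j, regs s' 10 = size R0, regs s' 14 = d
     & regs s' 12 = (j < N)],
   same_levels (table s) (table s') & memory s' = memory s].
have Rsz : size R = size R0 + N by rewrite size_cat.
have hspR s' j : rep (table s') (take (size R - j) R) -> top s' = n.+1 -> space s' <= S.
  move=> h1 h2; apply: (dom_ok_space (rep_dom h1) _ h2).
  by rewrite size_take_min (leq_trans (geq_minr _ _)).
apply: wp_seq.
apply: wp_mono (@wp_for w S 12 pop_body (fun _ => 4) N Inv s1 _ _ _) _; last 3 first.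
- by move=> s2 [h1 h2 [_ _ _ ->] _ _]; rewrite ltnn; split=> //; apply: hspR h1 (base_top h2).
- split=> //.
  + by rewrite subn0 take_size.
  + rewrite subn0 /s1; split; try lookup.
    by lookup_to; rewrite Rsz -[X in X < _]addn0 ltn_add2l.
- move=> t s2 [ht [h1 h2 [h3 h4 h5 _] h6 h7]].
  have E0 : size R - N = size R0 by rewrite Rsz addnK.
  rewrite E0 in h1 h3; rewrite take_size_cat // in h1.
  have [d1 d2 d3 d4 d5 d6 dtop dmem] := h2.
  have hsp2 : space s2 <= S.
    apply: dom_ok_space (rep_dom h1) _ dtop.
    by apply: leq_trans hR; rewrite Rsz leq_addr.
  run; first by rewrite addn0; apply: le_n_lt_word.
  rewrite sum_nat_const card_ord in ht.
  split; first by move: ht; rewrite /N; clear; lia.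
  split=> //.
  + by split; [lookup | lookup_to; rewrite addn0].
move=> j s2 hj [h1 h2 [h3 h4 h5 h6] h7 h8]; rewrite h6 hj; split=> //.
have [d1 d2 d3 d4 d5 d6 dtop dmem] := h2.
have hsp2 : space s2 <= S by apply: hspR h1 dtop.
have hjR : j < size R by rewrite Rsz (leq_trans hj) // leq_addl.
set m := size R - j.+1.
have Em : size R - j = m.+1 by rewrite /m subnSK.
have mR : m < size R by rewrite -Em leq_subr.
rewrite Em in h1 h3.
have Et : take m.+1 R = rcons (take m R) (nth [::] R m) by exact: take_nth.
have mT : m < size (take m.+1 R) by rewrite size_takel.
have g2 : get (table s2) 2 m = code (nth [::] R m) by rewrite (rep2 h1) // nth_take.
have hp := h1; rewrite Et in hp.
have uR' : uniq (rcons (take m R) (nth [::] R m)) by rewrite -Et take_uniq.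
have gR' x : x \in rcons (take m R) (nth [::] R m) -> good x.
  by rewrite -Et => /mem_take; exact: gR.
have hpop := rep_pop hp uR' gR'.
rewrite /pop_body; run.
  by rewrite ltn0Sn /=; apply: leq_ltn_trans hh; apply: leq_trans hR.
rewrite subn1 /=; run; first exact: g2.
have hspT s' : top s' = n.+1 ->
    space (set_table s' (table s2).[~ (1, code (nth [::] R m))]%fmap) <= S.
  by move=> h; apply: (@hspR (set_table s' _) j.+1 hpop).
run; first exact: hspT.
run; first exact: hspT.
split=> //; split.
- exact: hpop.
- by apply: (base_same h2) => // r hr; rewrite (regs_low hr) // regs_table !(regs_low hr).
- split; try lookup.
  lookup_to; rewrite /m Rsz; congr nat_of_bool; move: hj; clear; lia.
- by move=> c; have [<- <-] := h7 c; rewrite /= !get_rem.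
exact: h8.
Qed.

Lemma wp_push d R1 G Lr s : let R := R1 ++ G ++ Lr in
  base s -> rep (table s) R -> (forall x : seq nat, x \in R -> good x) ->
  (forall x : seq nat, x \in G ++ Lr -> size x = d) -> G != [::] ->
  {in G &, forall x y, key x = key y} ->
  (forall x L, Lr = x :: L -> key x != key (head [::] G)) ->
  uniq (R ++ expand G) -> size R + size (expand G) <= height ->
  (forall (tau : seq nat) i, tau \in expand G -> i < minn K d.+1 -> del_top i tau \in R) ->
  regs s 7 = d.+1 -> regs s 8 = size R -> regs s 9 = size R1 -> regs s 14 = d ->
  wp w S push_prog (fun t s' =>
    t <= size (expand G) * (100 * K + 4) + size G * 12 + 9 /\
    [/\ rep (table s') (R ++ expand G), base s',
       regs s' 7 = d.+2 /\ regs s' 8 = size R + size (expand G),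
       [/\ get (table s') 5 d.+1 = size R, get (table s') 6 d.+1 = size R,
           get (table s') 6 d = size R1 + size G, get (table s') 5 d = get (table s) 5 d
         & forall c, c < d -> get (table s') 5 c = get (table s) 5 c /\
             get (table s') 6 c = get (table s) 6 c]
     & mem_add s s' (fun m => (m == d.+2) * \sum_(x <- expand G) num_ext x)]) s.
Proof.
move=> R hb hrep gR szd G0 keyG keyL uR hR hdlt r7 r8 r9 r14.
have hin : head [::] G \in G by case: (G) G0 => //= x L _; rewrite inE eqxx.
have hinR : head [::] G \in R by rewrite /R !mem_cat hin orbT.
have gh := gR _ hinR; have szh : size (head [::] G) = d by apply: szd; rewrite mem_cat hin.
have hdn : d < n by case/and3P: gh; rewrite szh.
have hh := height_lt_word; have w1 := one_lt_word.
have hRh : size R <= height by apply: leq_trans hR; rewrite leq_addr.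
have hsp : space s <= S by apply: dom_ok_space (rep_dom hrep) hRh (base_top hb).
have [b1 b2 b3 b4 b5 b6 btop bmem] := hb.
have G0' : 0 < size G by case: (G) G0.
have g3 : get (table s) 3 (size R1) = encode b (head [::] G).
  rewrite (rep3 hrep); last by rewrite /R !size_cat -[X in X < _]addn0 ltn_add2l addn_gt0 G0'.
  by rewrite /R nth_cat ltnn subnn nth_cat G0' nth0.
rewrite /push_prog.
run; first by rewrite addn0; apply: leq_ltn_trans hh.
rewrite addn0; run; first exact: g3.
run; rewrite encode_key //.
run => //.
set s1 := set_reg _ 12 _.
apply: wp_seq.
apply: wp_mono (@wp_group d R1 G Lr s1 _ _ _ _ _ _ _ _ _ _ _ _ _ _ _) _ => //.
all: try by (rewrite /s1; lookup).
  by rewrite /s1; lookup_to; rewrite G0'.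
move=> t s2 [ht [p1 p2 [p8 p9 pfr] p56 pmem]].
have [d1 d2 d3 d4 d5 d6 dtop dmem] := p2.
have hRE : size (R ++ expand G) <= height by rewrite size_cat.
have hspA s' : rep (table s') (R ++ expand G) -> top s' = n.+1 -> space s' <= S.
  by move=> h1 h2; apply: dom_ok_space (rep_dom h1) hRE h2.
have hspT T s' : rep T (R ++ expand G) -> top s' = n.+1 -> space (set_table s' T) <= S.
  by move=> h1 h2; apply: (hspA (set_table s' T)).
have hsp2 : space s2 <= S by exact: hspA.
have c7 : regs s2 7 = d.+1 by rewrite pfr // /s1; lookup.
have c10 : regs s2 10 = size R by rewrite pfr // /s1; lookup.
have c14 : regs s2 14 = d by rewrite pfr // /s1; lookup.
have q1 := @rep_set_level _ _ 6 d (size R1 + size G) p1 isT (ltnW hdn).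
have q2 := @rep_set_level _ _ 5 d.+1 (size R) q1 isT hdn.
have q3 := @rep_set_level _ _ 6 d.+1 (size R) q2 isT hdn.
run; first exact: (hspT _ _ q1 dtop).
run.
  exact: (hspT _ _ q1 dtop).
  exact: (hspT _ _ q2 dtop).
run.
  exact: (hspT _ _ q2 dtop).
  exact: (hspT _ _ q3 dtop).
run.
  by apply: le_n1_lt_word; rewrite addn1.
  exact: (hspT _ _ q3 dtop).
split; first by move: ht; clear; lia.
split.
- exact: q3.
- by apply: (base_same p2) => // r hr; rewrite (regs_low hr).
- by split; [lookup_to; rewrite addn1 | lookup].
- rewrite /= !get_set /= !eqxx ?ltn_eqF //; split=> //.
    by have [] := p56 d.
  move=> c hc; rewrite !get_set /= (ltn_eqF hc) (ltn_eqF (leqW hc)).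
  exact: p56.
exact: pmem.
Qed.

(* [f] bounds the number of generations below [L]. *)
Fixpoint num_descendants f L :=
  if f is f'.+1 then size (expand L) + num_descendants f' (expand L) else 0.

Fixpoint increments f d L m :=
  if f is f'.+1 then
    (m == d.+2) * (\sum_(x <- expand L) num_ext x) + increments f' d.+1 (expand L) m
  else 0.

Lemma num_descendants_cat f L1 L2 :
  num_descendants f (L1 ++ L2) = num_descendants f L1 + num_descendants f L2.
Proof.
elim: f L1 L2 => //= f IH L1 L2; rewrite expand_cat size_cat IH; lia.
Qed.

Lemma increments_cat f d L1 L2 m :
  increments f d (L1 ++ L2) m = increments f d L1 m + increments f d L2 m.
Proof.
elim: f d L1 L2 => //= f IH d L1 L2; rewrite expand_cat big_cat /= IH; lia.
Qed.

Lemma increments_nil f d m : increments f d [::] m = 0.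
Proof. by elim: f d => //= f IH d; rewrite big_nil muln0 IH. Qed.

Record lower d (R0 : seq (seq nat)) : Prop := Lower {
  lower_uniq : uniq R0;
  lower_good : forall x : seq nat, x \in R0 -> good x /\ size x < d;
  lower_size : size R0 <= d * n ^ g }.

Record conf d R0 L c (s : state) : Prop := Conf {
  conf_base : base s;
  conf_rep : rep (table s) (R0 ++ L);
  conf7 : regs s 7 = d.+1;
  conf8 : regs s 8 = size (R0 ++ L);
  conf_start : get (table s) 5 d = size R0;
  conf_cur : get (table s) 6 d = c }.

Lemma lower_next d R0 L : lower d R0 -> level d L -> lower d.+1 (R0 ++ L).
Proof.
move=> [u h sz] hL; split.
- rewrite cat_uniq u (level_uniq hL) andbT /=; apply/hasPn => x /(level_mem hL)[_ sx].
  by apply/negP => /h[_]; rewrite sx ltnn.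
- move=> x; rewrite mem_cat => /orP[/h[gx sx]|/(level_mem hL)[gx ->]] //.
  by split=> //; exact: ltnW.
by rewrite size_cat mulSn addnC leq_add // (level_size n0 hL).
Qed.

Lemma lower_height d R0 : lower d R0 -> d <= n.+1 -> size R0 <= height.
Proof. by move=> h hd; apply: leq_trans (lower_size h) _; rewrite leq_mul2r hd orbT. Qed.

Definition popped d R0 (s s' : state) :=
  [/\ base s', rep (table s') R0, regs s' 7 = d /\ regs s' 8 = size R0
    & forall c, c < d -> get (table s') 5 c = get (table s) 5 c /\
        get (table s') 6 c = get (table s) 6 c].

Definition visits f := forall d R0 L s Q, n - d <= f -> d <= n -> level d L -> lower d R0 ->
  conf d R0 L (size R0) s ->
  (forall t s', t <= 200 * K * num_descendants f L + 60 * size L + 20 -> popped d R0 s s' ->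
     mem_add s s' (increments f d L) -> wp w S (While 7 main_body) (fun t2 => Q (t + t2)) s') ->
  wp w S (While 7 main_body) Q s.

Lemma visit_groups f d R0 L gs Ld s Q :
  (forall f', f = f'.+1 -> visits f') -> n - d <= f -> d <= n ->
  level d L -> lower d R0 -> L = Ld ++ flatten gs -> grouped d gs ->
  conf d R0 L (size R0 + size Ld) s ->
  (forall t s', t <= 200 * K * num_descendants f (flatten gs)
       + 55 * size (flatten gs) + 5 * size L + 20 ->
     popped d R0 s s' -> mem_add s s' (increments f d (flatten gs)) ->
     wp w S (While 7 main_body) (fun t2 => Q (t + t2)) s') ->
  wp w S (While 7 main_body) Q s.
Proof.
move=> IHf hf hd hL hR0.
have hR1 := lower_next hR0 hL.
have gR x : x \in R0 ++ L -> good x by case/(lower_good hR1).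
have hRh : size (R0 ++ L) <= height by apply: lower_height hR1 _.
have hdw : d.+1 < 2 ^ w by apply: le_n1_lt_word.
elim: gs Ld s Q => [|G gs IHg] Ld s Q EL hgs [hb hrep c7 c8 c5 c6] hQ.
all: have hsp : space s <= S by apply: dom_ok_space (rep_dom hrep) hRh (base_top hb).
all: have [b1 b2 b3 b4 b5 b6 btop bmem] := hb.
all: apply: wp_whileT; first by rewrite c7.
all: rewrite /main_body; run; first by [].
all: rewrite subn1 /=; run; first by exact: c6.
all: run; set s3 := set_reg _ 13 _.
all: have base3 : base s3 by apply: (base_same hb) => // r hr; rewrite /s3 !(regs_low hr).
all: apply: wp_if.
  rewrite cats0 in EL.
  have -> : regs s3 13 = 0 by rewrite /s3; lookup_to; rewrite EL size_cat ltnn.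
  apply: wp_mono (@wp_pop d R0 L s3 _ _ _ _ _ _ _ _ _) _ => //.
  - exact: lower_uniq hR1.
  move=> t s' [ht [p1 p2 [p3 p4] p5 p6]].
  apply: (hQ (1 + (1 + (1 + t.+1))).+1).
  - by move: ht; clear; lia.
  - by split=> // c _; exact: p5.
  - by apply: (mem_add0 hb) => // m; exact: increments_nil.
have [gs1 gs2 gs3 gs4] := hgs.
have GG : G \in G :: gs by rewrite inE eqxx.
have G0 := gs1 G GG; have lvG := gs2 G GG.
have G0' : 0 < size G by case: (G) G0.
have ER : R0 ++ L = (R0 ++ Ld) ++ G ++ flatten gs by rewrite EL -catA.
have szL x : x \in L -> size x = d by case/(level_mem hL).
have hin : head [::] G \in G by case: (G) G0 => //= x l _; rewrite inE eqxx.
have hdn : d < n.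
  have hinL : head [::] G \in L by rewrite EL /= !mem_cat hin orbT.
  by have [/and3P[_ _]] := level_mem hL hinL; move=> + E; rewrite E.
case: f IHf hf hQ IHg => [|f] IHf hf hQ IHg; first by move: hf hdn; clear; lia.
have subG x : x \in expand G -> x \in expand L.
  by move=> hx; rewrite EL /= !expand_cat !mem_cat hx orbT.
have hlow2 := lower_next hR1 lvG.
have hRE : size (R0 ++ L) + size (expand G) <= height.
  by rewrite -size_cat; apply: lower_height hlow2 _.
have -> : (if regs s3 13 != 0 then push_prog else pop_prog) = push_prog.
  suff -> : regs s3 13 = 1 by [].
  rewrite /s3; lookup_to; rewrite EL /= !size_cat; move: G0'; clear; lia.
apply: wp_mono (@wp_push d (R0 ++ Ld) G (flatten gs) s3 _ _ _ _ _ _ _ _ _ _ _ _ _ _) _ => //.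
- by rewrite -ER.
- by rewrite -ER.
- by move=> x; move=> hx; apply: szL; rewrite EL mem_cat hx orbT.
- exact: gs3.
- move=> x l El; case Egs : gs El => [|G2 gs'] //= El.
  have G2in : G2 \in G :: gs by rewrite Egs !inE eqxx orbT.
  have := gs1 G2 G2in; case: G2 El Egs G2in => [|y G2] //= [-> _] Egs _ _.
  by move: gs4; rewrite Egs /= inE negb_or eq_sym => /andP[/andP[]].
- by rewrite -ER; exact: lower_uniq hlow2.
- by rewrite -ER.
- move=> tau i htau hi; rewrite -ER mem_cat; apply/orP; right.
  by apply: (level_del_top _ hL _ hi); [exact: ltnW | exact: subG].
- by rewrite -ER.
- by rewrite size_cat.
rewrite -ER => t s4 [ht [p1 p2 [p3 p4] [p5 p6 p7 p8 p9] p10]].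
apply: (IHf f (erefl _) d.+1 (R0 ++ L) (expand G) s4) => //.
- by move: hf; clear; lia.
- by split=> //; rewrite size_cat.
move=> t2 s5 ht2 [q1 q2 [q3 q4] q5] q6.
have [q5d q6d] := q5 d (ltnSn d).
apply: (IHg (Ld ++ G) s5).
- by rewrite EL -catA.
- split=> [G' h|G' h|G' h|].
  + by apply: gs1; rewrite inE h orbT.
  + by apply: gs2; rewrite inE h orbT.
  + by apply: gs3; rewrite inE h orbT.
  + by move: gs4 => /= /andP[].
- split=> //.
  + by rewrite q5d p8.
  + by rewrite q6d p7 !size_cat addnA.
move=> t3 s6 ht3 [u1 u2 u3 u4] u5.
set t1 := 1 + _.
apply: wp_mono (hQ (t1 + t2 + t3).+1 s6 _ _ _) _ => [|||t4 s7]; last by rewrite addSn !addnA.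
- rewrite /t1 [flatten _]/= num_descendants_cat [num_descendants f.+1 G]/= size_cat.
  move: ht ht2 ht3 K1 G0'; clear; set a := size (expand G); set c := num_descendants f _.
  move: (num_descendants f.+1 _) (size (flatten gs)) (size G) (size L) => x y z v.
  by move: a c; nia.
- split=> // c hc; have [-> ->] := u4 c hc; have [-> ->] := q5 c (ltnW hc); exact: p9.
apply: (mem_add_trans (mem_add_trans (i3 := increments f.+1 d G) p10 q6 _) u5) => m //.
by rewrite -increments_cat.
Qed.

Lemma visit f : visits f.
Proof.
elim: f => [|f IHf] d R0 L s Q hf hd hL hR0 hs hQ.
all: have [gs hgs EL] := level_grouped K1 hL.
all: have hs' : conf d R0 L (size R0 + size (@nil (seq nat))) s by rewrite addn0.
  apply: (visit_groups (Ld := [::]) (f := 0) _ hf hd hL hR0 EL hgs hs') => // t s' ht.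
  by rewrite -EL in ht *; apply: hQ; move: ht; clear; lia.
apply: (visit_groups (Ld := [::]) (f := f.+1) _ hf hd hL hR0 EL hgs hs') => [f' [<-] //|t s' ht].
by rewrite -EL in ht *; apply: hQ; move: ht; clear; lia.
Qed.

End Search.

Section Output.
Hypothesis pPi : pattern_set Pi.
Hypothesis Ek : max_length Pi = k.

Lemma pos_pattern pi : pi \in Pi -> 0 < size pi.
Proof. by case/andP: pPi => _ /allP h /h /andP[]. Qed.

Lemma good_nil : good [::].
Proof. by rewrite /good /= avoiding_nil. Qed.

Lemma num_ext_nil : num_ext [::] = ([:: 1] \notin Pi).
Proof.
rewrite /num_ext /= addn0 (@avoiding_cons Pi n k K hPi (erefl _) 0 [::] good_nil) //=.
by rewrite andbT.
Qed.

Lemma max_length_gt0 : 0 < k.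
Proof.
case/andP: (pPi); case: Pi (hPi) (pos_pattern) => // pi s h1 h2 _ _.
have hin : pi \in pi :: s by rewrite inE eqxx.
by apply: leq_trans (h2 pi hin) _; have [] := h1 pi hin.
Qed.

Lemma K_gt1 : [:: 1] \notin Pi -> 1 < n -> 1 < K.
Proof.
move=> h1 hn; rewrite leq_min hn andbT.
case/andP: (pPi); case: Pi (hPi) (pos_pattern) h1 => // pi s hP hpos h1 _ _.
have hin : pi \in pi :: s by rewrite inE eqxx.
have [hp hk] := hP pi hin; apply: leq_trans hk; rewrite ltn_neqAle hpos // andbT.
apply: contraNneq h1 => E; rewrite -E in hp; suff -> : [:: 1] = pi by [].
by apply/esym/perm_small_eq => //.
Qed.

Lemma size_avoiders_lt_word m : m <= n -> size (avoiders Pi m) < 2 ^ w.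
Proof.
move=> hm; apply: leq_ltn_trans (_ : 2 ^ (b * m) < _); last first.
  by apply: pow_lt_word; apply: leq_bM_2bn.
rewrite /avoiders size_filter; apply: leq_trans (count_size _ _) _.
rewrite size_permutations ?iota_uniq // size_iota expnM.
by apply: fact_leq_exp; apply: leq_trans hm (ltnW nb).
Qed.

Lemma increments_small f d L m : m < d.+2 -> increments f d L m = 0.
Proof.
elim: f d L => //= f IH d L h; rewrite IH; last exact: leqW.
by rewrite (ltn_eqF h).
Qed.

Lemma increments_iter f d L m : d.+2 <= m -> m <= d.+1 + f ->
  increments f d L m = \sum_(x <- iter (m - d.+1) expand L) num_ext x.
Proof.
elim: f d L => [|f IH] d L h1 h2; first by move: h1 h2; clear; lia.
rewrite /=; have [->|ne] := eqVneq m d.+2.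
  by rewrite increments_small // mul1n addn0 subSS subSnn.
rewrite mul0n add0n IH; first last.
- by move: h2; clear; lia.
- by move: h1 ne; clear; lia.
by have -> : m - d.+1 = (m - d.+2).+1 by [move: h1 ne; clear; lia]; rewrite iterSr.
Qed.

Lemma num_descendants_sum f L : num_descendants f L = \sum_(0 <= j < f) size (iter j.+1 expand L).
Proof.
elim: f L => [|f IH] L; first by rewrite big_geq.
rewrite /= IH big_nat_recl //=; congr (_ + _).
by apply: eq_bigr => j _; rewrite -iterSr.
Qed.

Lemma num_descendants_avoiders : num_descendants n [:: [::]] = num_avoiders_le Pi n.-1.
Proof.
rewrite num_descendants_sum /num_avoiders_le -{1}(prednK n0) big_nat_recr //=.
have -> : size (expand (iter n.-1 expand [:: [::]])) = 0.
  apply/eqP; rewrite size_eq0; apply/eqP; rewrite -iterS prednK // -/(descend n [::]).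
  case E : (descend n [::]) => [|x L] //.
  have : x \in descend n [::] by rewrite E inE eqxx.
  rewrite mem_descend ?good_nil // addn0 => /and3P[/and3P[_ _ h] /eqP E2 _].
  by move: h; rewrite E2 ltnn.
rewrite addn0 big_add1 /=; apply: eq_big_nat => j /andP[_ hj].
by rewrite -(@size_descend_avoiders Pi n) //; move: hj; clear; lia.
Qed.

Lemma space_bound_le : S <= 40 * n ^ k.
Proof.
have [_ hc] := card_pattern_table b hPi pos_pattern n0.
have hk := max_length_gt0.
have hn : n <= n ^ k by rewrite -[X in X <= _]expn1 leq_pexp2l.
have hH : height <= 2 * n ^ k.
  rewrite /height; have hK : 0 < K by rewrite leq_min hk n0.
  apply: leq_trans (_ : (2 * n) * n ^ K.-1 <= _).
    by rewrite leq_mul2r; apply/orP; right; move: n0; clear; lia.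
  by rewrite -mulnA -expnS prednK // leq_mul2l leq_pexp2l // geq_minl.
rewrite /space_bound; move: hc hn hH n0; clear.
move: #|` _|%fset (height) (n ^ k) => x y z; lia.
Qed.

Lemma wp_count : wp w S count_prog
  (fun t s => (forall m, 1 <= m <= n -> memory s m = size (avoiders Pi m)) /\
     t <= 400 * maxn 1 (num_avoiders_le Pi n.-1 * k)) (init_state b n Pi).
Proof.
have w1 := one_lt_word; have w0 : 0 < 2 ^ w by exact: ltnW.
set s := init_state b n Pi.
have r0 : regs s 0 = n by [].
have r1 : regs s 1 = K by rewrite /= Ek.
have r2 : regs s 2 = b by [].
have r4 : regs s 4 = 0 by [].
have hsp : space s <= S by rewrite /space /= /space_bound leq_add2l leq_mul2l /= -addnA leq_addr.
have hav m : m < n -> size (avoiders Pi m.+1) = \sum_(x <- descend m [::]) num_ext x.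
  by move=> hm; exact: size_avoiders_sum.
have hav1 : size (avoiders Pi 1) = ([:: 1] \notin Pi).
  by rewrite hav // big_seq1 num_ext_nil.
rewrite /count_prog.
run => //.
run.
have -> : ((0, 1) \in domf (table (set_reg s 3 1))) = ([:: 1] \in Pi).
  rewrite [table _]/= -(@code_in_pattern_table 1 [:: 1]) //.
  by rewrite encode_cons encode_nil muln0.
run; first by rewrite w1 andbT; case: (_ \in _).
have -> : 1 - ([:: 1] \in Pi) = ([:: 1] \notin Pi) by case: (_ \in _).
run => //.
run.
run; first by rewrite mulnb; apply: leq_ltn_trans (leq_b1 _) w1.
set s1 := set_reg _ 13 _.
have e13 : regs s1 13 = ([:: 1] \notin Pi) && (1 < n) by rewrite /s1; lookup_to; rewrite mulnb.
have [/andP[h1 hn]|hno] := boolP (([:: 1] \notin Pi) && (1 < n)); last first.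
  apply: wp_ifF; first by rewrite e13 (negPf hno).
  have hsp1 : space s1 <= S by rewrite /s1; space_tac.
  run => //; split; last first.
    by apply: leq_trans (_ : 400 * 1 <= _); last by rewrite leq_mul2l leq_maxl.
  move=> m /andP[m1 mn]; rewrite /s1 /=; have [->|ne] := eqVneq m 1; first by rewrite hav1.
  move: hno; rewrite negb_and negbK => /orP[h1|]; last by move: m1 mn ne; clear; lia.
  case: m m1 mn ne => [|[|m]] // _ mn _; rewrite hav //.
  suff -> : descend m.+1 [::] = [::] by rewrite big_nil.
  rewrite /descend iterSr /expand /= cats0.
  suff -> : children [::] = [::] by rewrite iter_expand_nil.
  rewrite /children; case: ifP => // _; apply/eqP; rewrite -size_eq0 size_ext num_ext_nil.
  by rewrite h1.
apply: wp_ifT; first by rewrite e13 h1 hn.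
have K1 := K_gt1 h1 hn.
have hsp1 : space s1 <= S by rewrite /s1; space_tac.
have c0 : regs s1 0 = n by rewrite /s1; lookup.
have c1 : regs s1 1 = K by rewrite /s1; lookup.
have c2 : regs s1 2 = b by rewrite /s1; lookup.
have c3 : regs s1 3 = 1 by rewrite /s1; lookup.
have c4 : regs s1 4 = 0 by rewrite /s1; lookup.
have m1 m : memory s1 m = (m == 1) by rewrite /s1 /= h1; case: eqP.
have t1 : top s1 = n.+1 by [].
have T1 : table s1 = pattern_table b n Pi by [].
clearbody s1.
have hKn : K <= n by exact: geq_minr.
have hKw : K < 2 ^ w by exact: le_n_lt_word.
have R0h : size [:: [::] : seq nat] <= height by rewrite muln_gt0 expn_gt0 n0.
have hspA s' : top s' = n.+1 -> dom_ok (table s') [:: [::]] -> space s' <= S.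
  by move=> h h'; apply: (dom_ok_space K1 h' R0h h).
have E1 : bitmap [::] = 1.
  rewrite /bitmap /= ifT; last by rewrite -ltnS prednK.
  rewrite bits_rcons /bits encode_nil add0n muln1.
  by have := num_ext_nil; rewrite /num_ext /= addn0 h1.
have E2 : code [::] = 0 by exact: encode_nil.
have E3 := encode_nil b.
have hfst : forall x, x \in domf (pattern_table b n Pi) -> x.1 = 0.
  by have [] := card_pattern_table b hPi pos_pattern n0.
have rep0 : rep (pattern_table b n Pi) [::].
  split=> // x hx; have := hfst x hx; case: x hx => [h c] hx /= Eh; rewrite Eh in hx *.
  by rewrite /allowed.
have hT4 : rep (pattern_table b n Pi).[(1, 0) <- 1].[(2, 0) <- 0].[(3, 0) <- 0]
    .[(4, 0) <- 0]%fmap [:: [::]].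
  have := @rep_push K1 _ [::] [::] rep0; rewrite E1 E2 /= E3.
  by apply => //; exact: good_nil.
have hT5 := @rep_set_level _ _ 5 0 0 hT4 isT (leq0n n).
have hT6 := @rep_set_level _ _ 6 0 0 hT5 isT (leq0n n).
have hd0 : dom_ok (pattern_table b n Pi) [:: [::]].
  by apply: dom_ok_mono (rep_dom rep0) _.
have a1 : allowed [:: [::]] (1, 0) by rewrite /allowed /= inE E2.
have a2 : allowed [:: [::]] (2, 0) by [].
have a3 : allowed [:: [::]] (3, 0) by [].
have a4 : allowed [:: [::]] (4, 0) by [].
have hd1 := @dom_ok_set _ _ _ _ 1 hd0 a1.
have hd2 := @dom_ok_set _ _ _ _ 0 hd1 a2.
have hd3 := @dom_ok_set _ _ _ _ 0 hd2 a3.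
have hd4 := rep_dom hT4; have hd5 := rep_dom hT5; have hd6 := rep_dom hT6.
have hspT s' T : top s' = n.+1 -> dom_ok T [:: [::]] -> space (set_table s' T) <= S.
  by move=> h h'; apply: (hspA (set_table s' T)).
rewrite -T1 in hd0 hd1 hd2 hd3 hd4 hd5 hd6.
rewrite /loop_prog.
run; first exact: leq_ltn_trans K1 hKw.
run; first by rewrite K1 hKw.
rewrite subn2; run.
  apply: lin_lt_word; apply: leq_bM_2bn; apply: leq_trans hKn.
  by rewrite -!subn1 (leq_trans (leq_subr _ _)) ?leq_subr.
run; first by rewrite n0; exact: le_n_lt_word.
rewrite subn1.
run; first exact: hspT hd1.
run; [exact: hspT hd1 | exact: hspT hd2 | ].
run; [exact: hspT hd2 | exact: hspT hd3 | ].
run; [exact: hspT hd3 | exact: hspT hd4 | ].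
run; [exact: hspT hd4 | exact: hspT hd5 | ].
run; [exact: hspT hd5 | exact: hspT hd6 | ].
run; [exact: w1 | exact: hspT hd6 | ].
run; [exact: w1 | exact: hspT hd6 | ].
set s2 := set_reg _ 7 _.
have Tab2 : rep (table s2) [:: [::]] by rewrite /s2 /= T1.
have base2 : base s2.
  split; rewrite /s2; try lookup; first exact: t1.
  move=> m; rewrite /= m1; exact: leq_ltn_trans (leq_b1 _) w1.
have lv : level 0 [:: [::]].
  exists [::]; first by rewrite good_nil.
  by rewrite min0n.
have lw : lower 0 [::] by split.
have cf : conf 0 [::] [:: [::]] (size (@nil (seq nat))) s2.
  split=> //; try by rewrite /s2; lookup.
    by rewrite /s2 /= !get_set.
  by rewrite /s2 /= !get_set.
apply: (@visit K1 n 0 [::] [:: [::]] s2) => //.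
  by rewrite subn0.
move=> t s3 ht [p1 p2 [p3 p4] p5] p6.
have hsp3 : space s3 <= S.
  by apply: (dom_ok_space K1 (rep_dom p2) _ (base_top p1)).
apply: wp_whileF => //; split.
  move=> m /andP[hm0 hmn]; rewrite p6.
  have -> : memory s2 m = (m == 1) by rewrite /s2 /= m1.
  case: m hm0 hmn => [|[|m]] // _ hmn.
    by rewrite increments_small // hav1 h1 addn0 modn_small.
  rewrite add0n increments_iter //; last by rewrite add1n leqW.
  rewrite subn1 -[iter _ _ _]/(descend m.+1 [::]) -hav // modn_small //.
  exact: size_avoiders_lt_word.
move: ht; rewrite num_descendants_avoiders; set N := num_avoiders_le Pi n.-1 => ht.
have N1 : 0 < N.
  rewrite /N /num_avoiders_le (@big_ltn _ _ _ 1); last by rewrite prednK.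
  by rewrite hav1 h1.
have hKk : K <= k by exact: geq_minl.
have hk := max_length_gt0.
have : 0 < N * k by rewrite muln_gt0 N1.
move: ht; rewrite [size _]/=; set t' := 1 + _ => ht hNk.
have h2 : K * N <= N * k by rewrite mulnC leq_mul2l hKk orbT.
apply: leq_trans (_ : 400 * (N * k) <= _); last by rewrite leq_mul2l leq_maxr orbT.
by move: ht h2 hNk; rewrite /t' -mulnA; clear; lia.
Qed.
End Output.
End Algorithm.

Theorem theorem6p4 :
  exists (P : prog) (A C : nat),
  forall (Pi : seq (seq nat)) (k n b w : nat),
    pattern_set Pi -> max_length Pi = k ->
    0 < n -> n < 2 ^ b -> A * (n * b) <= w ->
  exists (t q : nat) (s : state),
    [/\ exec w P (init_state b n Pi) t q s,
        forall m : nat, 1 <= m <= n -> memory s m = size (avoiders Pi m),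
        t <= C * maxn 1 (num_avoiders_le Pi n.-1 * k)
      & q <= C * n ^ k].
Proof.
exists count_prog, 4, 400 => Pi k n b w pPi Ek n0 nb hw.
have hPi (pi : seq nat) : pi \in Pi -> is_perm (size pi) pi /\ size pi <= k.
  move=> hin; case/andP: (pPi) => _ /allP /(_ pi hin) /andP[_ hp]; split=> //.
  by rewrite -Ek /max_length; exact: (@leq_bigmax_seq _ Pi xpredT size pi hin isT).
have [t [q [s [h1 h2 [h3 h4]]]]] := wp_count hPi n0 nb hw pPi Ek.
exists t, q, s; split=> //; apply: leq_trans h2 _.
apply: leq_trans (_ : 40 * n ^ k <= _); first by eapply space_bound_le; eassumption.
by rewrite leq_mul2r orbT.
Qed.
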